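(* Let $X$ be a regular CW complex and let $r\ge 2$ be an integer. Let $F_r\colon P(X)\to\mathbf{Top}$ be the functor given by $F_r(\sigma)=\mathtt{Conf}_{r-1}(X(\sigma))$ for each face $\sigma$ of $X$, with $F_r(\sigma>\tau)\colon \mathtt{Conf}_{r-1}(X(\sigma))\to\mathtt{Conf}_{r-1}(X(\tau))$ the inclusion for $\sigma>\tau$. Then there is a homeomorphism $$\mathtt{Conf}_r(X)\cong\operatorname{hocolim} F_r.$$
   Context: A face of a regular CW complex $X$ means a closed cell of $X$. $P(X)$ denotes the face poset of $X$ (faces ordered by inclusion). For a face $\sigma$, $X(\sigma)$ denotes the subcomplex of $X$ consisting of all faces that do not intersect $\sigma$; note $X(\sigma)\subset X(\tau)$ if $\sigma>\tau$. The discretized configuration space $\mathtt{Conf}_r(X)$ is the subcomplex of the direct product $X^r$ consisting of the faces $\sigma_1\times\cdots\times\sigma_r$ such that $\sigma_1,\ldots,\sigma_r$ are pairwise disjoint faces of $X$. A poset $P$ is regarded as a category whose objects are the elements of $P$, with a unique morphism $x\to y$ for $x>y$ (besides identities). For $x\in P$, $P_{\le x}=\{y\in P\mid y\le x\}$, and the order complex $\Delta(P)$ is the geometric realization of the abstract simplicial complex whose simplices are finite chains $x_0<\cdots<x_n$ in $P$. For a functor $F\colon P\to\mathbf{Top}$, $\operatorname{hocolim}F$ is the coequalizer of the two maps $$f,g\colon\coprod_{x<y\in P}\Delta(P_{\le x})\times F(y)\to\coprod_{x\in P}\Delta(P_{\le x})\times F(x)$$ given by $f=\coprod_{x<y}1_{\Delta(P_{\le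 x})}\times F(y>x)$ and $g=\coprod_{x<y}\iota_{x,y}\times 1_{F(y)}$, where $\iota_{x,y}\colon\Delta(P_{\le x})\to\Delta(P_{\le y})$ is the inclusion. *)

(* Defs.v *)
From Stdlib Require Import Relations.
From HB Require Import structures.
From mathcomp Require Import all_boot all_order all_algebra finmap generic_quotient.
From mathcomp Require Import all_classical all_reals topology normedtype.

Set Implicit Arguments.
Unset Strict Implicit.
Unset Printing Implicit Defensive.

Import Order.TTheory GRing.Theory Num.Theory.
Import numFieldNormedType.Exports.
Import SetOrder.Exports.

Local Open Scope classical_set_scope.
Local Open Scope quotient_scope.
Local Open Scope ring_scope.

Definition homeomorphic (S T : topologicalType) : Prop :=
  exists (f : S -> T) (g : T -> S),
    [/\ continuous f, continuous g, cancel f g & cancel g f].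

Definition embedding_on (S T : topologicalType) (A : set S) (f : S -> T) :
  Prop :=
  {within A, continuous f} /\
  exists g : T -> S,
    {within f @` A, continuous g} /\ (forall x, A x -> g (f x) = x).

(* The set T with the weak topology determined by the family F: a set is open
   iff its trace on each member A of F is open in A for the topology that A
   inherits from T. *)
Definition coherent (T : topologicalType) (F : set (set T)) : Type := T.

Section CoherentTopology.
Context {T : topologicalType} (F : set (set T)).

HB.instance Definition _ := Choice.copy (coherent F) T.

Definition coherent_open (U : set (coherent F)) : Prop :=
  forall A : set T, F A -> @open (subspace A) U.

Lemma coherent_openT : coherent_open setT.
Proof. by move=> A _; exact: openT. Qed.

Lemma coherent_openI : setI_closed coherent_open.
Proof. by move=> U V oU oV A FA; apply: openI; [exact: oU|exact: oV]. Qed.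

Lemma coherent_open_bigU (I : Type) (f : I -> set (coherent F)) :
  (forall i, coherent_open (f i)) -> coherent_open (\bigcup_i f i).
Proof. by move=> of_ A FA; apply: bigcup_open => i _; exact: of_. Qed.

HB.instance Definition _ := isOpenTopological.Build (coherent F)
  coherent_openT coherent_openI coherent_open_bigU.

End CoherentTopology.

(* Balls and spheres are those of the Euclidean norm; the norm that the library
   puts on row vectors is the sup norm. *)
Definition disk (R : realType) (n : nat) : set 'rV[R]_n :=
  [set v | \sum_(i < n) v 0 i ^+ 2 <= 1].
Definition odisk (R : realType) (n : nat) : set 'rV[R]_n :=
  [set v | \sum_(i < n) v 0 i ^+ 2 < 1].
Definition sphere (R : realType) (n : nat) : set 'rV[R]_n :=
  [set v | \sum_(i < n) v 0 i ^+ 2 = 1].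

(* A Hausdorff space partitioned into open cells, with characteristic maps that
   are homeomorphisms onto their images (regularity), closure-finite, and
   carrying the weak topology determined by its closed cells. *)
Record regularCW (R : realType) := RegularCW {
  cw_space :> topologicalType;
  cw_index : Type;
  cw_dim : cw_index -> nat;
  cw_char : forall c, 'rV[R]_(cw_dim c) -> cw_space;
  cw_hausdorff : hausdorff_space cw_space;
  cw_embedding : forall c, embedding_on (@disk R (cw_dim c)) (@cw_char c);
  cw_cover : forall x, exists c, (@cw_char c @` @odisk R (cw_dim c)) x;
  cw_disjoint : forall c d x, (@cw_char c @` @odisk R (cw_dim c)) x ->
    (@cw_char d @` @odisk R (cw_dim d)) x -> c = d;
  cw_boundary : forall c, exists D : set cw_index,
    [/\ finite_set D, (forall d, D d -> (cw_dim d < cw_dim c)%N) &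
      @cw_char c @` @sphere R (cw_dim c) `<=`
        \bigcup_(d in D) (@cw_char d @` @odisk R (cw_dim d))];
  cw_weak : forall A : set cw_space,
    (forall c, closed (A `&` (@cw_char c @` @disk R (cw_dim c)))) -> closed A
}.

Section Faces.
Context {R : realType} (X : regularCW R).

Definition closed_cells : set (set X) :=
  [set A | exists c : cw_index X, A = @cw_char R X c @` @disk R (cw_dim c)].

Definition face : Type := set_type closed_cells.

Fact face_display : Order.disp_t. Proof. exact: Order.Disp tt tt. Qed.

(* The order inherited from the inclusion order of [set X]. *)
HB.instance Definition _ := SubChoice.on face.
HB.instance Definition _ :=
  [SubChoice_isSubPOrder of face by <: with face_display].

Definition face_set (s : face) : set X := val s.

Lemma face_leP (s t : face) : (s <= t)%O <-> face_set s `<=` face_set t.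
Proof. by rewrite leEsub -subsetEset. Qed.

(* A subcomplex is represented by the set of its faces. *)
Record subcomplex := Subcomplex {
  in_subcomplex : set face;
  subcomplex_down : forall s t : face,
    in_subcomplex s -> (t <= s)%O -> in_subcomplex t
}.

Definition full : subcomplex :=
  @Subcomplex setT (fun _ _ _ _ => I).

Lemma avoiding_down (s : face) (t u : face) :
  face_set t `&` face_set s = set0 -> (u <= t)%O ->
  face_set u `&` face_set s = set0.
Proof.
move=> ts0 /face_leP ut; apply/seteqP; split=> // x [/ut tx sx].
by rewrite -ts0.
Qed.

Definition avoiding (s : face) : subcomplex :=
  @Subcomplex [set t | face_set t `&` face_set s = set0] (@avoiding_down s).

Definition cell_product (r : nat) (s : 'I_r -> face) : set ('I_r -> X) :=
  [set p | forall i, face_set (s i) (p i)].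

(* X^r with its CW topology, i.e. the weak topology determined by the products
   of closed cells; it may be finer than the product topology if X is not
   locally finite. *)
Definition cw_power (r : nat) : topologicalType :=
  @coherent (prod_topology (fun _ : 'I_r => cw_space X))
    [set cell_product s | s in [set: 'I_r -> face]].

Definition conf_set (r : nat) (D : subcomplex) : set (cw_power r) :=
  [set p | exists s : 'I_r -> face,
    [/\ forall i, in_subcomplex D (s i),
        forall i j, i != j -> face_set (s i) `&` face_set (s j) = set0 &
        cell_product s p]].

(* The discretized configuration space of the subcomplex D. *)
Definition Conf (r : nat) (D : subcomplex) : topologicalType :=
  set_type (@conf_set r D).

End Faces.

Section OrderComplex.
Context (R : realType) {d : Order.disp_t} {P : porderType d}.

(* Points are written in barycentric coordinates. *)
Definition simplex (s : {fset P}) : set (P -> R) :=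
  [set a | [/\ forall x, 0 <= a x, forall x, x \notin s -> a x = 0 &
               \sum_(x <- s) a x = 1]].

Definition chain_in (Q : set P) (s : {fset P}) : Prop :=
  (forall x, x \in s -> Q x) /\
  (forall x y, x \in s -> y \in s -> (x <= y)%O \/ (y <= x)%O).

Definition simplices (Q : set P) :
    set (set (prod_topology (fun _ : P => (R : topologicalType)))) :=
  [set simplex s | s in chain_in Q].

(* The geometric realization of the order complex of the subposet Q of P, with
   the weak topology determined by its simplices. *)
Definition order_complex (Q : set P) : topologicalType :=
  set_type (\bigcup_(A in simplices Q) A : set (coherent (simplices Q))).

Definition below (x : P) : set P := [set y | (y <= x)%O].

Lemma below_incl (x y : P) (a : P -> R) : (x < y)%O ->
  (\bigcup_(A in simplices (below x)) A) a ->
  (\bigcup_(A in simplices (below y)) A) a.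
Proof.
move=> xy [_ [s [sx cs] <-] sa]; exists (simplex s) => //.
by exists s => //; split=> // z /sx zx; exact: le_trans (ltW xy).
Qed.

Definition order_complex_incl (x y : P) (xy : (x < y)%O) (a : order_complex (below x)) :
    order_complex (below y) :=
  SigSub (mem_set (below_incl xy (set_valP a))).

End OrderComplex.

Section Coequalizer.
Context {S T : topologicalType} (f g : S -> T).

Definition coeq_rel : rel T := fun a b =>
  `[< clos_refl_sym_trans T (fun u v => exists z, u = f z /\ v = g z) a b >].

Lemma coeq_rel_refl : reflexive coeq_rel.
Proof. by move=> a; apply/asboolP; exact: rst_refl. Qed.

Lemma coeq_rel_sym : symmetric coeq_rel.
Proof. by move=> a b; apply/asboolP/asboolP; exact: rst_sym. Qed.

Lemma coeq_rel_trans : transitive coeq_rel.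
Proof.
move=> b a c /asboolP ab /asboolP bc; apply/asboolP; exact: rst_trans ab bc.
Qed.

Canonical coeq_equiv :=
  EquivRel coeq_rel coeq_rel_refl coeq_rel_sym coeq_rel_trans.

Definition coequalizer : topologicalType :=
  quotient_topology {eq_quot coeq_equiv}.

End Coequalizer.

(* A functor P -> Top, where P has a unique non-identity morphism x -> y for
   each x > y; identities are left implicit. *)
Record functor d (P : porderType d) := Functor {
  fobj :> P -> topologicalType;
  fmap : forall x y : P, (y < x)%O -> fobj x -> fobj y;
  fmap_continuous : forall x y (yx : (y < x)%O), continuous (fmap yx);
  fmap_comp : forall x y z (yx : (y < x)%O) (zy : (z < y)%O) (u : fobj x),
    fmap zy (fmap yx u) = fmap (lt_trans zy yx) u
}.

Section Hocolim.
Context (R : realType) {d : Order.disp_t} {P : porderType d} (F : functor P).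

Definition hocolim_arrows : topologicalType :=
  {xy : {xy : P * P | (xy.1 < xy.2)%O} &
    (order_complex R (below (val xy).1) * F (val xy).2)%type}.

Definition hocolim_objects : topologicalType :=
  {x : P & (order_complex R (below x) * F x)%type}.

Definition hocolim_f (z : hocolim_arrows) : hocolim_objects :=
  let: existT xy au := z in
  existT _ (val xy).1 (au.1, fmap (valP xy) au.2).

Definition hocolim_g (z : hocolim_arrows) : hocolim_objects :=
  let: existT xy au := z in
  existT _ (val xy).2 (order_complex_incl (valP xy) au.1, au.2).

Definition hocolim : topologicalType := coequalizer hocolim_f hocolim_g.

End Hocolim.

Section ConfFunctor.
Context {R : realType} (X : regularCW R) (r : nat).

Lemma conf_incl (s t : face X) (p : cw_power X r) : (t < s)%O ->
  conf_set (avoiding s) p -> conf_set (avoiding t) p.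
Proof.
move=> /ltW /face_leP ts [c [cD cdisj cp]]; exists c; split=> // i; apply/seteqP.
by split=> // x [cx /ts sx]; rewrite -(cD i).
Qed.

Definition conf_map (s t : face X) (ts : (t < s)%O)
    (p : Conf r (avoiding s)) : Conf r (avoiding t) :=
  SigSub (mem_set (conf_incl ts (set_valP p))).

Lemma conf_map_continuous (s t : face X) (ts : (t < s)%O) :
  continuous (conf_map ts).
Proof.
apply/continuousP => _ [U oU <-]; exists U => //.
Qed.

Lemma conf_map_comp (s t u : face X) (ts : (t < s)%O) (ut : (u < t)%O)
    (p : Conf r (avoiding s)) :
  conf_map ut (conf_map ts p) = conf_map (lt_trans ut ts) p.
Proof. exact: val_inj. Qed.

Definition conf_functor : functor (face X) :=
  Functor conf_map_continuous conf_map_comp.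

End ConfFunctor.

(* Main.v *)
Require Import Defs.
From Stdlib Require Import Relations.
From mathcomp Require Import all_boot all_order all_algebra finmap
  generic_quotient.
From mathcomp Require Import all_classical all_reals topology normedtype
  realfun.
From mathcomp Require Import ring lra.

(* The barycentric coordinates of the barycentric subdivision identify each
   closed cell with the order complex of its faces, compatibly with inclusions
   of faces: a point of an open cell lies on a radius of the cell, and is a
   convex combination of the vertex of that cell and of the coordinates of the
   end of the radius on the boundary.  Under this identification the point of
   the hocolim represented by a face s, a point x of s and a configuration p in
   X(s) is the configuration (x, p); conversely (x, p) comes from the smallest
   face containing x, and all other representatives are related to this one by
   arrows.  The coordinates are a bijection onto the order complex only because
   a closed cell of a regular CW complex is a union of cells.  This rests on
   invariance of domain, applied to the maps from patches of the boundary sphere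
   of a cell to the cells of one dimension less; invariance of domain itself is
   derived from a cubical form of Sperner's lemma. *)

Set Implicit Arguments.
Unset Strict Implicit.
Unset Printing Implicit Defensive.

Import Order.TTheory GRing.Theory Num.Theory.
Import numFieldNormedType.Exports.

Local Open Scope ring_scope.

(** * A cubical Sperner lemma *)

(** Two obstacles shape the proof. The axiom on boundaries only covers the boundary sphere of a cell
    by finitely many open cells of lower dimension; it does not say that a cell met by this sphere
    lies in it. That is a local statement about dimension, which is where invariance of domain
    enters. The other obstacle is topological. Configurations carry the weak topology of products of
    closed cells, whereas the homotopy colimit is glued from ordinary products. The gluing map is
    continuous because an order complex can be traded for a closed cell, and a compact Hausdorff
    factor is compatible with weak topologies. The inverse map uses the carrier of the first point,
    which jumps from cell to cell; its continuity comes from formulas on products of pairwise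
    disjoint faces, each of which keeps one fixed face for the first point. A product of closed
    cells contains only finitely many such products of faces of its factors, so closed pasting
    applies. *)

Lemma addrr_bool (x : bool) : x + x = 0. Proof. by case: x. Qed.

Section CubicalCup.
Variables (n N : nat).
Local Notation V := {ffun 'I_n -> 'I_N.+1}.
Implicit Types (A : {set 'I_n}) (s : V -> bool) (ss : seq (V -> bool)) (u v w :
  V).

(** The step is cyclic, so that it permutes the whole grid and the cocycle identity holds without
    boundary conditions; [subgrid] later excludes the steps that wrap around. *)
Definition grid_step (a : 'I_n) (v : V) : V :=
  [ffun b => if b == a then ordS (v b) else v b].

Lemma grid_stepC a b v :
  grid_step a (grid_step b v) = grid_step b (grid_step a v).
Proof.
by apply/ffunP=> c; rewrite !ffunE; case: eqP => // ->; case: eqP.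
Qed.

(** With [bool] as the field of two elements, this is the cup product of the coboundaries of the
    0-cochains [ss], evaluated on the cube with lower corner [v] and directions [A]: an edge at [v],
    followed by the complementary cube at the end of that edge. *)
Fixpoint cup ss A (v : V) : bool :=
  if ss is s :: ss' then
    \sum_(a in A) (s (grid_step a v) + s v) * cup ss' (A :\ a) (grid_step a v)
  else 1.

Lemma sum_offdiag_exchange A (F : 'I_n -> 'I_n -> bool) :
  \sum_(a in A) \sum_(b in A :\ a) F a b =
  \sum_(b in A) \sum_(a in A :\ b) F a b.
Proof.
rewrite (exchange_big_dep (mem A)) /= => [|a b aA /finset.setD1P[]//].
apply: eq_bigr => b bA; apply: eq_bigl => a.
by rewrite !inE bA andbT eq_sym andbC.
Qed.

(** In characteristic 2 the terms at [(a, b)] and [(b, a)] cancel. *)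
Lemma sum_offdiag_sym A (F : 'I_n -> 'I_n -> bool) :
  (forall a b, F a b = F b a) -> \sum_(a in A) \sum_(b in A :\ a) F a b = 0.
Proof.
move=> FC; transitivity
  (\sum_(a in A) \sum_(b in A | (b < a)%N) F a b +
   \sum_(a in A) \sum_(b in A | (a < b)%N) F a b).
  rewrite -big_split; apply: eq_bigr => a aA /=.
  rewrite (bigID (fun b : 'I_n => (b < a)%N)) /=; congr (_ + _).
    by apply: eq_bigl => b; rewrite !inE -val_eqE /=; case: ltngtP;
      rewrite ?andbF ?andbT.
  by apply: eq_bigl => b; rewrite !inE -val_eqE /=; case: ltngtP;
    rewrite ?andbF ?andbT.
have -> : \sum_(a in A) \sum_(b in A | (b < a)%N) F a b =
          \sum_(a in A) \sum_(b in A | (a < b)%N) F a b.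
  rewrite (exchange_big_dep (mem A)) /=; last by move=> a b _ /andP[].
  by apply: eq_bigr => b bA; apply: eq_big => [a|a _]; rewrite ?bA.
exact: addrr_bool.
Qed.

(* The cup product of coboundaries is a cocycle. *)
Lemma cup_cocycle ss A v :
  \sum_(a in A) cup ss (A :\ a) (grid_step a v) = \sum_(a in A) cup ss
    (A :\ a) v.
Proof.
elim: ss A v => [//|s ss IH] A v /=.
have C a b : A :\ a :\ b = A :\ b :\ a by rewrite !finset.setDDl finset.setUC.
transitivity (\sum_(a in A) s (grid_step a v) *
                \sum_(b in A :\ a) cup ss (A :\ a :\ b) (grid_step a v)).
  under eq_bigr => a _ do under eq_bigr => b _ do rewrite mulrDl.
  under eq_bigr => a _ do rewrite big_split /= -mulr_sumr IH.
  rewrite big_split /= sum_offdiag_sym ?add0r// => a b.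
  by rewrite grid_stepC C.
under [RHS]eq_bigr => a _ do under eq_bigr => b _ do rewrite mulrDl.
under [RHS]eq_bigr => a _ do rewrite big_split /=.
rewrite big_split /= [X in _ = X + _]sum_offdiag_exchange.
rewrite [X in _ = _ + X](_ : _ = 0).
  rewrite addr0; apply: eq_bigr => a _; rewrite mulr_sumr.
  by apply: eq_bigr => b _; rewrite C.
under eq_bigr => a _ do rewrite -mulr_sumr IH.
by rewrite -mulr_sumr sum_offdiag_sym ?mulr0// => a b; rewrite C.
Qed.


(** The cube at [v] with directions [A] keeps coordinate [j] fixed, so [f j] is constant on it and
    the factor given by its coboundary vanishes. *)
Lemma cup_const (f : 'I_n -> V -> bool) (l : seq 'I_n) A v (j : 'I_n) (c :
  bool) :
  j \in l -> j \notin A -> (forall w, w j = v j -> f j w = c) ->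
  cup (map f l) A v = 0.
Proof.
move=> + jA fc; elim: l A v jA fc => //= i l IH A v jA fc jl.
apply: big1 => a aA.
have step_j : grid_step a v j = v j.
  by rewrite ffunE; case: eqP => // ja; rewrite ja aA in jA.
move: jl; rewrite inE => /orP[/eqP <-|jl].
  by rewrite !fc// addrr_bool mul0r.
rewrite (IH (A :\ a)) ?mulr0//; first by rewrite inE (negPf jA) andbF.
by move=> w; rewrite step_j => /fc.
Qed.

(** These are the lower corners of the unit cubes in the face of the grid that extends in the
    directions [A] and sits at [w] in the others; at [ord_max] the cyclic step would wrap around. *)
Definition subgrid A (w v : V) : bool :=
  [forall b, if b \in A then v b != ord_max else v b == w b].

Definition upd (w : V) a x : V := [ffun b => if b == a then x else w b].

Lemma subgridD1 A w v a x :
  a \in A -> subgrid (A :\ a) (upd w a x) v =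
  (v a == x) && [forall b, (b != a) ==>
                  (if b \in A then v b != ord_max else v b == w b)].
Proof.
move=> aA; apply/forallP/andP=> [H|[/eqP va /forallP H] b].
  split; first by have := H a; rewrite !inE eqxx/= ffunE eqxx.
  apply/forallP=> b; apply/implyP=> /negPf ba.
  by have := H b; rewrite !inE ba/= ffunE ba.
rewrite !inE ffunE; case: eqP => [->|/eqP ba] /=; first by rewrite va.
exact: implyP (H b) ba.
Qed.

Lemma subgrid_at A w v a :
  a \in A -> subgrid A w v =
  (v a != ord_max) && [forall b, (b != a) ==>
                  (if b \in A then v b != ord_max else v b == w b)].
Proof.
move=> aA; apply/forallP/andP=> [H|[va /forallP H] b].
  split; first by have := H a; rewrite aA.
  by apply/forallP=> b; apply/implyP=> _; exact: H.
by have [->|ba] := eqVneq b a; [rewrite aA|exact: implyP (H b) ba].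
Qed.

Lemma ordS_eq0 (x : 'I_N.+1) : (ordS x == ord0) = (x == ord_max).
Proof.
have [->|xm] := eqVneq x ord_max; first by apply/eqP/val_inj; rewrite /= modnn.
apply/negbTE; rewrite -val_eqE /= modn_small//.
by rewrite ltnS ltn_neqAle -ltnS ltn_ord andbT.
Qed.

Lemma grid_step_inj a : injective (grid_step a).
Proof.
move=> u v /ffunP uv; apply/ffunP=> b; move: (uv b); rewrite !ffunE.
by case: eqP => // _ /ordS_inj.
Qed.

(** Along each line in direction [a] the interior values occur twice and cancel, which leaves the
    two end faces; these are distinct since [0 < N]. *)
Lemma telescope_subgrid A w a (phi : V -> bool) : (0 < N)%N -> a \in A ->
  \sum_(v : V | subgrid A w v) phi (grid_step a v) +
    \sum_(v : V | subgrid A w v) phi v =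
  \sum_(v : V | subgrid (A :\ a) (upd w a ord_max) v) phi v +
    \sum_(v : V | subgrid (A :\ a) (upd w a ord0) v) phi v.
Proof.
move=> N0 aA.
pose Q (v : V) := [forall b, (b != a) ==>
                  (if b \in A then v b != ord_max else v b == w b)].
have EA v : subgrid A w v = (v a != ord_max) && Q v by exact: subgrid_at.
have EM v : subgrid (A :\ a) (upd w a ord_max) v = (v a == ord_max) && Q v.
  exact: subgridD1.
have E0 v : subgrid (A :\ a) (upd w a ord0) v = (v a == ord0) && Q v.
  exact: subgridD1.
have Qstep v : Q (grid_step a v) = Q v.
  by apply: eq_forallb => b; rewrite ffunE; case: eqP.
have -> : \sum_(v : V | subgrid A w v) phi (grid_step a v) =
          \sum_(v : V | (v a != ord0) && Q v) phi v.
  rewrite [RHS](reindex_inj (@grid_step_inj a)) /=; apply: eq_bigl => v.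
  by rewrite EA Qstep ffunE eqxx ordS_eq0.
have max0 : (ord_max : 'I_N.+1) != ord0 by rewrite -val_eqE /= -lt0n.
rewrite (bigID (fun v : V => v a == ord_max)) /=.
rewrite [X in _ + X](bigID (fun v : V => v a == ord0)) /=.
rewrite (eq_bigl (fun v : V => subgrid (A :\ a) (upd w a ord_max) v));
  last first.
  by move=> v; rewrite EM; have [->|_] := eqVneq (v a) ord_max;
    rewrite ?max0 ?andbT ?andbF.
rewrite -!addrA; congr (_ + _); rewrite addrCA.
rewrite (eq_bigl (fun v : V => subgrid (A :\ a) (upd w a ord0) v)); last first.
  move=> v; rewrite EA E0; have [->|_] := eqVneq (v a) ord0;
    by rewrite ?andbT ?andbF// eq_sym max0.
rewrite [X in _ + (X + _)](eq_bigl (fun v : V =>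
  subgrid A w v && (v a != ord0))).
  by rewrite addrr_bool addr0.
by move=> v; rewrite EA andbAC -[RHS]andbAC; congr (_ && _); rewrite andbC.
Qed.

(** A discrete Stokes formula reduces the sum to the boundary of the grid. The faces orthogonal to
    [a != i] contribute nothing, because [f a] is constant there; on the lower face orthogonal to
    [i] the factor [f i] is 0, and on the upper one it is 1, which leaves the sum of one dimension
    less. *)
Lemma sum_cup (f : 'I_n -> V -> bool) (l : seq 'I_n) w :
  (0 < N)%N -> uniq l ->
  (forall i v, i \in l -> v i = ord0 -> f i v = false) ->
  (forall i v, i \in l -> v i = ord_max -> f i v = true) ->
  \sum_(v : V | subgrid [set x in l] w v) cup (map f l) [set x in l] v = 1.
Proof.
move=> N0; elim: l w => [|i l IH] w /=.
  move=> _ _ _; rewrite (big_pred1 w)// => v.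
  apply/forallP/eqP=> [H|-> b]; last by rewrite inE /= eqxx.
  by apply/ffunP=> b; have := H b; rewrite inE => /eqP.
move=> /andP[il ul] f0 f1; set A := [set x in i :: l].
have AD : A :\ i = [set x in l].
  by apply/finset.setP=> x; rewrite !inE; have [->|//] := eqVneq x i;
    rewrite (negPf il).
under eq_bigr => v _ do under eq_bigr => a _ do rewrite mulrDl.
(* In the second half of the sum the cocycle identity moves the remaining product from the end of
   the edge back to [v], so that both halves are values of the same [phi]. *)
under eq_bigr => v _ do rewrite big_split /= -mulr_sumr cup_cocycle mulr_sumr.
rewrite big_split /= exchange_big /= [X in _ + X]exchange_big -big_split /=.
pose phi a v := f i v * cup (map f l) (A :\ a) v.
rewrite (eq_bigr (fun a =>
  \sum_(v : V | subgrid (A :\ a) (upd w a ord_max) v) phi a v +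
    \sum_(v : V | subgrid (A :\ a) (upd w a ord0) v) phi a v)); last first.
  by move=> a aA; rewrite -telescope_subgrid.
rewrite (bigD1 i) /=; last by rewrite !inE eqxx.
have side a x v : a \in A -> subgrid (A :\ a) (upd w a x) v -> v a = x.
  by move=> aA; rewrite subgridD1// => /andP[/eqP].
have iA : i \in A by rewrite !inE eqxx.
rewrite [X in _ + X]big1 ?addr0; last first.
  move=> a /andP[aA ai]; have al : a \in l by move: aA; rewrite !inE (negPf ai).
  rewrite !big1 ?addr0// => v /side va; rewrite /phi.
    rewrite (cup_const (c := false) al) ?mulr0 ?inE ?eqxx// => u.
    by rewrite va// => ua; rewrite f0// inE al orbT.
  rewrite (cup_const (c := true) al) ?mulr0 ?inE ?eqxx// => u.
  by rewrite va// => ua; rewrite f1// inE al orbT.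
rewrite [X in _ + X]big1 ?addr0; last first.
  by move=> v /side vi; rewrite /phi f0 ?mem_head ?vi// mul0r.
rewrite -(IH (upd w i ord_max))//; first last.
- by move=> j v jl; apply: f1; rewrite inE jl orbT.
- by move=> j v jl; apply: f0; rewrite inE jl orbT.
rewrite -AD; apply: eq_bigr => v /side vi.
by rewrite /phi f1 ?mem_head ?vi// mul1r.
Qed.

(** A nonzero product has a nonzero term: a lattice path from [v] in distinct directions of [A],
    each labelling changing along its own edge. The vertices [p] and [q] are the ends of that
    edge. *)
Lemma cup_neq0 (f : 'I_n -> V -> bool) (l : seq 'I_n) A v :
  cup (map f l) A v != 0 -> forall i, i \in l ->
  exists p q : V, [/\ forall b, p b = v b \/ b \in A /\ p b = ordS (v b),
    forall b, q b = v b \/ b \in A /\ q b = ordS (v b) & f i p != f i q].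
Proof.
elim: l A v => //= j l IH A v.
case: (boolP [exists a in A, (f j (grid_step a v) + f j v) *
    cup [seq f i | i <- l] (A :\ a) (grid_step a v) != 0]); last first.
  move=> /exists_inPn H /negP[]; apply/eqP/big1 => a /H.
  by rewrite negbK => /eqP.
move=> /exists_inP[a aA /=]; rewrite mulf_eq0 negb_or => /andP[fj Bl] _ i.
have stepP b : grid_step a v b = v b \/ b \in A /\ grid_step a v b = ordS (v b).
  by rewrite ffunE; case: eqP => [->|]; [right|left].
rewrite inE => /orP[/eqP ->|/(IH _ _ Bl)[p [q [Hp Hq pq]]]].
  exists (grid_step a v), v; split=> //; first by move=> b; left.
  by apply: contraNneq fj => ->; rewrite addrr_bool.
have ext (u : V) : (forall b, u b = grid_step a v b \/
      b \in A :\ a /\ u b = ordS (grid_step a v b)) ->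
    forall b, u b = v b \/ b \in A /\ u b = ordS (v b).
  move=> Hu b; have [->|[/finset.setD1P[ba bA] ->]] := Hu b; first exact: stepP.
  by right; rewrite ffunE (negPf ba).
by exists p, q; split=> //; exact: ext.
Qed.

(** The products over all unit cubes add up to 1, so one of them is nonzero, and every labelling
    changes on that cube. *)
Lemma cubical_sperner (f : 'I_n -> V -> bool) : (0 < N)%N ->
  (forall i v, v i = ord0 -> f i v = false) ->
  (forall i v, v i = ord_max -> f i v = true) ->
  exists2 v : V, (forall b, (v b < N)%N) &
    forall i, exists p q : V, [/\ forall b, (v b <= p b <= (v b).+1)%N,
      forall b, (v b <= q b <= (v b).+1)%N & f i p != f i q].
Proof.
move=> N0 f0 f1.
have /eqP := @sum_cup f (enum 'I_n) [ffun=> ord0] N0 (enum_uniq _)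
  (fun i v _ => @f0 i v) (fun i v _ => @f1 i v).
case: (boolP [exists v : V, subgrid [set x in enum 'I_n] [ffun=> ord0] v &&
    (cup (map f (enum 'I_n)) [set x in enum 'I_n] v != 0)]); last first.
  move=> /existsPn H; rewrite big1 // => v Pv; have := H v; rewrite Pv /= negbK.
  by move=> /eqP.
move=> /existsP[v /andP[/forallP Pv /cup_neq0 H]] _.
have vN b : (v b < N)%N.
  have := Pv b; rewrite inE mem_enum -val_eqE /= ltn_neqAle => ->.
  by rewrite -ltnS ltn_ord.
exists v => // i; have [|p [q [Hp Hq pq]]] := H i; first by rewrite mem_enum.
have ext (u : V) : (forall b, u b = v b \/ b \in [set x in enum 'I_n] /\
  u b = ordS (v b)) ->
    forall b, (v b <= u b <= (v b).+1)%N.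
  move=> Hu b; have [->|[_ ->]] := Hu b; first by rewrite leqnn leqnSn.
  by rewrite /= modn_small ?leqnn ?leqnSn// ltnS.
by exists p, q; split=> //; exact: ext.
Qed.

End CubicalCup.

(** * Maps near the identity on the cube *)

Local Open Scope classical_set_scope.
Local Open Scope quotient_scope.
Local Open Scope ring_scope.

Section SupNorm.
Context {R : realType} {n : nat}.
Implicit Types (x y : 'rV[R]_n) (e : R).

Lemma rV_norm_le x e : 0 <= e -> (`|x| <= e) <-> (forall i, `|x 0 i| <= e).
Proof.
move=> e0; rewrite [ `|x| ]mx_normrE; split=> [/bigmax_leP[_ H] i|H].
  exact: (H (0, i)).
by apply/bigmax_leP; split=> // -[j i] _ /=; rewrite ord1.
Qed.

Lemma rV_norm_lt x e : 0 < e -> (`|x| < e) <-> (forall i, `|x 0 i| < e).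
Proof.
move=> e0; rewrite [ `|x| ]mx_normrE; split=> [/bigmax_ltP[_ H] i|H].
  exact: (H (0, i)).
by apply/bigmax_ltP; split=> // -[j i] _ /=; rewrite ord1.
Qed.

Lemma rV_norm_coord x i : `|x 0 i| <= `|x|.
Proof. by apply: (rV_norm_le x (normr_ge0 x)).1. Qed.

Definition cube e : set 'rV[R]_n := [set x | `|x| <= e].

Lemma compact_cube e : compact (cube e).
Proof.
apply: bounded_closed_compact.
  exists e; split; first exact: num_real.
  by move=> M eM x /= /le_trans; apply; exact: ltW.
apply: (@closed_comp _ _ (fun x : 'rV[R]_n => `|x|) [set r | r <= e]).
  by move=> x _; exact: norm_continuous.
exact: closed_le.
Qed.

End SupNorm.
Arguments cube {R} n e.

Section NormWithin.
Context {R : realType} {V W : normedModType R} (A : set V) (f : V -> W).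

Lemma within_norm_lt x e : {within A, continuous f} -> A x -> 0 < e ->
  exists2 d, 0 < d & forall y, A y -> `|x - y| < d -> `|f x - f y| < e.
Proof.
move=> /subspace_continuousP cf Ax e0.
have := cf _ Ax _ (nbhsx_ballx (f x) e e0).
rewrite /= withinE => -[U /nbhs_ballP[d /= d0 dU] UA].
exists d => // y Ay xy.
have : (U `&` A) y by split=> //; apply: dU; rewrite -ball_normE.
by rewrite -UA => -[]; rewrite /= -ball_normE.
Qed.

End NormWithin.

Lemma rV_dist_coord {R : realType} n (x y : 'rV[R]_n) i :
  `|x 0 i - y 0 i| <= `|x - y|.
Proof. by have := rV_norm_coord (x - y) i; rewrite !mxE. Qed.

(* Poincare-Miranda: a map close to the identity on the boundary of the cube
   takes both signs in each coordinate on arbitrarily small cubes. *)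
Lemma near_identity_zero {R : realType} n (h : 'rV[R]_n -> 'rV[R]_n) :
  {within cube n 1, continuous h} ->
  (forall x i, cube n 1 x -> `|h x 0 i - x 0 i| < 1) ->
  exists2 x, cube n 1 x & h x = 0.
Proof.
move=> ch hx; apply: contrapT => noz.
(* Without zeros, some coordinate of [h] keeps its sign near each point. Compactness makes the
   radius [e] uniform, which a grid of mesh below [e] will contradict. *)
pose P (e : R) x := exists i,
  (forall y, cube n 1 y -> `|x - y| < e -> 0 < h y 0 i) \/
  (forall y, cube n 1 y -> `|x - y| < e -> h y 0 i < 0).
have : \forall e \near 0^'+, cube n 1 `<=` P e.
  have /compact_near_coveringP/near_covering_withinP := @compact_cube R n 1.
  apply => x Cx.
  have [i hxi] : exists i, h x 0 i != 0.
    apply: contrapT => H; apply: noz; exists x => //; apply/rowP => i.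
    by rewrite mxE; apply: contrapT => /eqP hi; apply: H; exists i.
  have [d d0 Hd] := within_norm_lt ch Cx (etrans (normr_gt0 _) hxi).
  have d20 : 0 < d / 2 by rewrite divr_gt0.
  exists (ball x (d / 2), [set e | e < d / 2]).
    split=> /=; first exact: nbhsx_ballx.
    exact: nbhs_right_lt.
  move=> [x' e] /= [+ ed] Cx'; rewrite -ball_normE /= => xx'.
  have main y : cube n 1 y -> `|x' - y| < e ->
    `|h x 0 i - h y 0 i| < `|h x 0 i|.
    move=> Cy x'y; apply: le_lt_trans (rV_dist_coord _ _ _) (Hd _ Cy _).
    rewrite (splitr d) -(subrKA x'); apply: le_lt_trans (ler_normD _ _) _.
    by rewrite ltrD// (lt_trans x'y).
  exists i; have [hp|hp] : 0 < h x 0 i \/ h x 0 i < 0.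
    by move: hxi; rewrite neq_lt => /orP[]; [right|left].
  - left=> y Cy /(main _ Cy); rewrite (gtr0_norm hp) ltr_norml => /andP[_]; lra.
  - right=> y Cy /(main _ Cy); rewrite (ltr0_norm hp) ltr_norml => /andP[]; lra.
move=> /(filterI (nbhs_right_gt 0))/filter_ex[e [/= e0 HP]].
have [N N0 Ne] : exists2 N : nat, (0 < N)%N & 2 / N%:R < e.
  exists (Num.bound (2 / e)).+1 => //;
    rewrite ltr_pdivrMr// mulrC -ltr_pdivrMr//.
  rewrite (lt_trans (archi_boundP _))// ?ltr_nat//.
  by rewrite divr_ge0// ltW.
have N0R : 0 < N%:R :> R by rewrite ltr0n.
pose pt (v : {ffun 'I_n -> 'I_N.+1}) : 'rV[R]_n :=
  \row_i (2 * (v i)%:R / N%:R - 1).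
have Cpt v : cube n 1 (pt v).
  apply/rV_norm_le => // i; rewrite mxE ler_norml.
  have vN : (v i)%:R <= N%:R :> R by rewrite ler_nat -ltnS ltn_ord.
  have v0 : 0 <= (v i)%:R :> R by [].
  have : 2 * (v i)%:R / N%:R <= 2 :> R by rewrite ler_pdivrMr// ler_wpM2l.
  have : 0 <= 2 * (v i)%:R / N%:R :> R by rewrite divr_ge0 ?mulr_ge0.
  by move=> *; apply/andP; split; lra.
(* Since [h] moves coordinates by less than 1, its coordinate [i] is negative where that of the
   point is -1 and positive where it is 1: the boundary conditions of the Sperner lemma. *)
pose f i v := 0 < h (pt v) 0 i.
have [v vN Hv] : exists2 v : {ffun 'I_n -> 'I_N.+1}, (forall b, (v b < N)%N) &
    forall i, exists p q : {ffun 'I_n -> 'I_N.+1},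
      [/\ forall b, (v b <= p b <= (v b).+1)%N,
      forall b, (v b <= q b <= (v b).+1)%N & f i p != f i q].
  apply: cubical_sperner => // i v vi.
    apply/negbTE; rewrite -leNgt.
    have := hx _ i (Cpt v); rewrite mxE vi /= mulr0 mul0r ltr_norml => /andP[];
      lra.
  have := hx _ i (Cpt v); rewrite mxE vi /= mulfK ?gt_eqF// ltr_norml /f =>
    /andP[]; lra.
have close (p : {ffun 'I_n -> 'I_N.+1}) :
  (forall b, (v b <= p b <= (v b).+1)%N) -> `|pt v - pt p| < e.
  move=> Hp; apply: le_lt_trans Ne; apply/rV_norm_le => [|i];
    first by rewrite divr_ge0.
  rewrite !mxE; have /andP[] := Hp i;
    rewrite -(ler_nat R) -(ler_nat R (p i)) => h1 h2.
  rewrite -natr1 in h2.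
  have -> : 2 * (v i)%:R / N%:R - 1 - (2 * (p i)%:R / N%:R - 1) =
    (2 / N%:R) * ((v i)%:R - (p i)%:R) :> R by ring.
  rewrite normrM ger0_norm ?divr_ge0// ler_piMr ?divr_ge0//.
  by rewrite ler_norml; apply/andP; split; lra.
have [i Hi] := HP _ (Cpt v).
have [p [q [Hp Hq]]] := Hv i.
case: Hi => Hi; rewrite /f.
  by rewrite !Hi//; exact: close.
have sgn (u : {ffun 'I_n -> 'I_N.+1}) :
    (forall b, (v b <= u b <= (v b).+1)%N) -> (0 < h (pt u) 0 i) = false.
  by move=> /close /(Hi _ (Cpt u)) /ltW; rewrite leNgt => /negbTE.
by rewrite !sgn.
Qed.

(** * Invariance of domain *)

Lemma rV_norm_attained {R : realType} n (x : 'rV[R]_n.+1) :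
  exists i, `|x| = `|x 0 i|.
Proof.
apply: contrapT; have [->|x0] := eqVneq x 0 => H.
  by apply: H; exists ord0; rewrite normr0 mxE normr0.
have : `|x| < `|x|; last by rewrite ltxx.
apply/rV_norm_lt => [|i]; first by rewrite normr_gt0.
rewrite lt_neqAle rV_norm_coord andbT; apply/eqP => xi.
by apply: H; exists i.
Qed.

Lemma nearby_ordinal {R : realType} (N : nat) (t : R) : (0 < N)%N ->
  0 <= t <= N%:R -> exists j : 'I_N, j%:R <= t <= j%:R + 1.
Proof.
move=> N0 /andP[t0 tN].
have /andP[h1 h2] := truncn_itv t0; rewrite -natr1 in h2.
have [jN|] := ltnP (Num.trunc t) N.
  by exists (Ordinal jN) => /=; rewrite h1 ltW.
case: N N0 tN => // N _ tN NT; exists ord_max => /=.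
by rewrite natr1 tN andbT (le_trans _ h1)// ler_nat ltnW.
Qed.

(* The sphere is covered by O(N^m) cells of size O(1/N), while the values to be
   avoided are chosen among M^(m+1) points with M proportional to N. *)
Lemma lipschitz_sphere_misses {R : realType} m (P : 'rV[R]_m.+1 -> 'rV[R]_m.+1)
    (c : 'rV[R]_m.+1) (e L rho : R) : 0 < e -> 0 < L -> 0 < rho ->
  (forall y y', `|y - c| = e -> `|y' - c| = e ->
    `|P y - P y'| <= L * `|y - y'|) ->
  exists2 s, `|s| <= rho & forall y, `|y - c| = e -> P y <> s.
Proof.
move=> e0 L0 rho0 PL.
pose K := (Num.bound (2 * e * L / rho)).+1.
have HK : 2 * e * L / rho < K%:R.
  rewrite (lt_trans (archi_boundP _))// ?ltr_nat//.
  by rewrite divr_ge0 ?mulr_ge0// ltW.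
(* The [2 * m.+1 * N ^ m] cells of the sphere are then fewer than the [M ^ m.+1] candidate values,
   and the image of a cell has diameter at most [L * (2 * e / N) < rho / M], below the distance
   between two candidates. *)
pose M := (2 * m.+1 * K ^ m).+1; pose N := (K * M)%N.
have N0 : (0 < N)%N by rewrite muln_gt0.
have N0R : 0 < N%:R :> R by rewrite ltr0n.
have M0R : 0 < M%:R :> R by rewrite ltr0n.
pose I : finType := ('I_m.+1 * bool * {ffun 'I_m -> 'I_N})%type.
pose w := 2 * e / N%:R.
have w0 : 0 < w by rewrite divr_gt0 ?mulr_gt0.
(* The pair [(i, b)] names a facet of the sup-norm sphere that contains [y], and [j] a grid cube of
   that facet. *)
pose Q (y : 'rV[R]_m.+1) (z : I) := let: (i, b, j) := z in
  y 0 i - c 0 i = (-1) ^+ b * e /\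
  forall k, (j k)%:R * w <= y 0 (lift i k) - c 0 (lift i k) + e <=
    ((j k)%:R + 1) * w.
have exQ y : `|y - c| = e -> exists z, Q y z.
  move=> yc; have [i yi] := rV_norm_attained (y - c); rewrite yc !mxE in yi.
  have /choice[j Hj] : forall k : 'I_m, exists j : 'I_N,
      j%:R * w <= y 0 (lift i k) - c 0 (lift i k) + e <= (j%:R + 1) * w.
    move=> k; have := rV_dist_coord y c (lift i k);
      rewrite yc ler_norml => /andP[h1 h2].
    have [|j] :=
      @nearby_ordinal _ _ ((y 0 (lift i k) - c 0 (lift i k) + e) / w) N0.
      rewrite divr_ge0 ?(ltW w0)//=; last by lra.
      by rewrite ler_pdivrMr// /w [_ * (_ / _)]mulrC divfK ?gt_eqF//; lra.
    by rewrite ler_pdivrMr// ler_pdivlMr// => H; exists j.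
  exists (i, y 0 i - c 0 i < 0, [ffun k => j k]); split=> [|k];
    last by rewrite ffunE.
  rewrite yi; case: ltP => [/ltr0_norm ->|/ger0_norm ->].
    by rewrite expr1 mulN1r opprK.
  by rewrite expr0 mul1r.
have closeQ y y' z : Q y z -> Q y' z -> `|y - y'| <= w.
  case: z => -[i b] j [yi yj] [y'i y'j]; apply/rV_norm_le => [|l];
    first exact: ltW.
  rewrite !mxE; have [k ->|->] := unliftP i l; last first.
    have /addIr -> : y 0 i - c 0 i = y' 0 i - c 0 i by rewrite yi y'i.
    by rewrite subrr normr0 ltW.
  have := yj k; have := y'j k;
    rewrite !mulrDl !mul1r => /andP[a1 a2] /andP[b1 b2].
  by rewrite ler_norml; apply/andP; split; lra.
pose s (k : {ffun 'I_m.+1 -> 'I_M}) : 'rV[R]_m.+1 :=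
  \row_i (rho * (k i)%:R / M%:R).
have srho k : `|s k| <= rho.
  apply/rV_norm_le => [|i]; first exact: ltW.
  rewrite mxE ger0_norm ?divr_ge0 ?mulr_ge0 ?(ltW rho0)//.
  rewrite ler_pdivrMr// ler_wpM2l ?(ltW rho0)//.
  by rewrite ler_nat ltnW.
apply: contrapT => noS.
have /choice[z Hz] : forall k, exists z, exists2 y, `|y - c| = e /\
  P y = s k & Q y z.
  move=> k; apply: contrapT => H; apply: noS; exists (s k) => // y yc Py.
  by have [z Qz] := exQ y yc; apply: H; exists z; exists y.
have zinj : injective z.
  move=> k k' zz; have [y [yc Py] Qy] := Hz k; have [y' [yc' Py'] Qy'] := Hz k'.
  apply: contrapT => kk'.
  have [i ki] : exists i, k i != k' i.
    apply: contrapT => H; apply: kk'; apply/ffunP => i.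
    by apply: contrapT => /eqP ki; apply: H; exists i.
  rewrite -zz in Qy'.
  have := le_trans (PL _ _ yc yc') (ler_wpM2l (ltW L0) (closeQ _ _ _ Qy Qy')).
  move=> /(le_trans (rV_dist_coord _ _ i)); rewrite Py Py' !mxE -mulrBl -mulrBr.
  rewrite normrM normrM (gtr0_norm rho0) [ `|M%:R^-1| ]gtr0_norm ?invr_gt0//.
  have k1 : 1 <= `|(k i)%:R - (k' i)%:R : R|.
    have : (1 <= `|(k i : int) - (k' i : int)|%R).
      by rewrite -gtz0_ge1 normr_gt0 subr_eq0 eqz_nat.
    by rewrite -(ler_int R) intr_norm rmorphB.
  rewrite leNgt => /negP; apply.
  have : rho / M%:R <= rho * `|(k i)%:R - (k' i)%:R| / M%:R.
    by rewrite ler_wpM2r ?invr_ge0// ler_peMr// ltW.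
  move=> H; apply: lt_le_trans H; rewrite ltr_pdivlMr// /w /N natrM.
  have K0R : 0 < K%:R :> R by rewrite ltr0n.
  have -> : L * (2 * e / (K%:R * M%:R)) * M%:R = 2 * e * L / K%:R.
    by field; rewrite !gt_eqF.
  by rewrite ltr_pdivrMr// [rho * _]mulrC -ltr_pdivrMr.
have := leq_card z zinj.
rewrite !card_prod !card_ffun !card_ord card_bool /N expnMn leqNgt => /negP;
  apply.
by rewrite expnS mulnA ltn_pmul2r ?expn_gt0// mulnAC ltnS mulnC mulnA.
Qed.

Lemma cvg_rV {R : realType} (T : Type) (F : set_system T) n
    (f : T -> 'rV[R]_n) (l : 'rV[R]_n) : Filter F ->
  (forall i, (fun x => f x 0 i) @ F --> l 0 i) -> f @ F --> l.
Proof.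
move=> FF fl A [P Pl PA].
have : \forall x \near F, forall i, P 0 i (f x 0 i).
  by apply: filter_forall => i; apply: fl; exact: Pl.
by apply: filterS => x Px; apply: PA => i j; rewrite ord1; exact: Px.
Qed.

Lemma continuous_coord {R : realType} n (i : 'I_n) :
  continuous (fun x : 'rV[R]_n => x 0 i).
Proof.
move=> x A nA; exists (fun _ j => if j == i then A else setT).
  by move=> k j; case: eqP => [->|_]; [rewrite ord1|exact: filterT].
by move=> y /(_ 0 i); rewrite eqxx.
Qed.

(** Compactness is applied to pairs of points: near the diagonal the points are close, and near any
    other pair their images stay apart by a fixed amount. *)
Lemma uniform_inverse {R : realType} n (f : 'rV[R]_n -> 'rV[R]_n) e :
  {within cube n 1, continuous f} -> {in cube n 1 &, injective f} -> 0 < e ->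
  exists2 d, 0 < d & forall x x', cube n 1 x -> cube n 1 x' ->
    `|f x - f x'| < d -> `|x - x'| < e.
Proof.
move=> cf fi e0.
pose P (d : R) (p : 'rV[R]_n * 'rV[R]_n) :=
  `|f p.1 - f p.2| < d -> `|p.1 - p.2| < e.
have : \forall d \near 0^'+, cube n 1 `*` cube n 1 `<=` P d.
  have /compact_near_coveringP/near_covering_withinP :=
    compact_setX (@compact_cube R n 1) (@compact_cube R n 1).
  apply => -[x x'] [/= Cx Cx'].
  have [<-{x' Cx'}|/eqP xx'] := pselect (x = x').
    exists (ball x (e / 2) `*` ball x (e / 2), setT).
      split=> /=; last exact: filterT.
      by exists (ball x (e / 2), ball x (e / 2)) => //; split;
        apply: nbhsx_ballx; rewrite divr_gt0.
    move=> [[y y'] d] /= [[+ +] _] _ _; rewrite -ball_normE /= => xy xy'.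
    rewrite (splitr e) -(subrKA x); apply: le_lt_trans (ler_normD _ _) _.
    by rewrite ltrD// distrC.
  have fxx' : 0 < `|f x - f x'|.
    rewrite normr_gt0 subr_eq0; apply: contra_neq xx' => /fi.
    by apply; rewrite inE.
  set a := `|_| in fxx'; have a4 : 0 < a / 4 by rewrite divr_gt0.
  have [d d0 Hd] := within_norm_lt cf Cx a4.
  have [d' d'0 Hd'] := within_norm_lt cf Cx' a4.
  exists (ball x d `*` ball x' d', [set r | r < a / 4]).
    split=> /=; last exact: nbhs_right_lt.
    by exists (ball x d, ball x' d') => //; split; exact: nbhsx_ballx.
  move=> [[y y'] r] /= [[+ +] ra] [Cy Cy'];
    rewrite -ball_normE /= => xy xy' ffr.
  have := Hd y Cy xy; have := Hd' y' Cy' xy'; rewrite distrC => h1 h2.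
  have : a < a; last by rewrite ltxx.
  rewrite {1}/a -(subrKA (f y)) -[f y - _](subrKA (f y')) addrA.
  apply: le_lt_trans (ler_normD _ _) _.
  have := ler_normD (f x - f y) (f y - f y'); simpl in ffr.
  by move: h1 h2 ffr ra fxx'; rewrite -/a; lra.
move=> /(filterI (nbhs_right_gt 0))/filter_ex[d [/= d0 Hd]].
by exists d => // x x' Cx Cx'; exact: (Hd (x, x')).
Qed.

Lemma lipschitz_continuous {R : realType} {V : normedModType R} (g : V -> R) L :
  0 < L -> (forall y y', `|g y - g y'| <= L * `|y - y'|) -> continuous g.
Proof.
move=> L0 gL y; apply/cvgrPdist_lt => r r0; near=> z.
apply: le_lt_trans (gL _ _) _; rewrite -ltr_pdivlMl// mulrC.
near: z; have := nbhsx_ballx y _ (divr_gt0 r0 L0).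
by rewrite -ball_normE [r / L]mulrC.
Unshelve. all: by end_near. Qed.

Section RadialPush.
Context {R : realType} {n : nat} (c : 'rV[R]_n) (e : R).

(** Inside the sup-norm ball of radius [e] about [c] this is, away from [c], the radial projection
    to its sphere; outside the ball it is the identity. *)
Definition radial_push (y : 'rV[R]_n) : 'rV[R]_n :=
  c + Num.max (e / `|y - c|) 1 *: (y - c).

(** The bound to which the coordinates of the approximate inverse are clamped: constantly 1/10
    within distance [e] of [c], and at least 1, hence harmless on the cube, from distance [2 * e]
    on. *)
Definition radial_bound (y : 'rV[R]_n) : R :=
  10^-1 + Num.max 0 (`|y - c| - e) / e.

Lemma continuous_dist_to : continuous (fun z : 'rV[R]_n => `|z - c|).
Proof.
move=> y; apply: (@continuous_comp _ _ _ (fun z : 'rV[R]_n => z - c)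
  (fun z => `|z|)); last exact: norm_continuous.
apply: (@continuousB _ _ _ id (fun=> c)); first exact: cvg_id.
exact: cst_continuous.
Qed.

Lemma radial_push_continuous y : y != c -> {for y, continuous radial_push}.
Proof.
move=> yc.
apply: (@continuousD _ _ _ (fun=> c) (fun y : 'rV[R]_n =>
  Num.max (e / `|y - c|) 1 *: (y - c))).
  exact: cst_continuous.
apply: (@continuousZ _ _ _ (fun y : 'rV[R]_n => Num.max (e / `|y - c|) 1)
  (fun y : 'rV[R]_n => y - c)); last first.
  apply: (@continuousB _ _ _ id (fun=> c)); last exact: cst_continuous.
  exact: cvg_id.
apply: (@continuous_max _ _ (fun y : 'rV[R]_n => e / `|y - c|) (fun=> 1));
  last exact: cst_continuous.
apply: (@continuousM _ _ (fun=> e) (fun y : 'rV[R]_n => `|y - c|^-1)).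
  exact: cst_continuous.
have yc0 : `|y - c| != 0 by rewrite normr_eq0 subr_eq0.
exact: (cvgV yc0 (@continuous_dist_to y)).
Qed.

Lemma radial_bound_continuous : continuous radial_bound.
Proof.
move=> y; apply: (@continuousD _ _ _ (fun=> 10^-1 : R) (fun y : 'rV[R]_n =>
  Num.max 0 (`|y - c| - e) / e)).
  exact: cst_continuous.
apply: (@continuousM _ _ (fun y : 'rV[R]_n => Num.max 0 (`|y - c| - e)) (fun=>
  e^-1)); last exact: cst_continuous.
apply: (@continuous_max _ _ (fun=> 0) (fun y : 'rV[R]_n => `|y - c| - e));
  first exact: cst_continuous.
apply: (@continuousB _ _ _ (fun y : 'rV[R]_n => `|y - c|) (fun=> e)).
  exact: continuous_dist_to.
exact: cst_continuous.
Qed.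

End RadialPush.

Lemma continuous_rV {R : realType} (T : topologicalType) n (f : T ->
  'rV[R]_n) x :
  (forall i : 'I_n, {for x, continuous (fun y : T => f y 0 i)}) ->
    {for x, continuous f}.
Proof. by move=> H; apply: cvg_rV. Qed.

Definition clamp {R : realType} (m h : R) := Num.max (- m) (Num.min m h).

Lemma clamp_norm {R : realType} (m h : R) : 0 <= m -> `|clamp m h| <= m.
Proof.
move=> m0; rewrite /clamp ler_norml le_max lexx /= ge_max ge_min lexx /= andbT.
by rewrite (le_trans _ m0)// oppr_le0.
Qed.

Lemma clamp_lipschitz {R : realType} (m h h' : R) :
  `|clamp m h - clamp m h'| <= `|h - h'|.
Proof.
have := ler_norm (h' - h); have := ler_norm (h - h'); rewrite (distrC h' h).
rewrite /clamp => h1 h2; have [?|?] := leP m h; have [?|?] := leP m h';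
  have [?|?] := leP (- m) m; have [?|?] := leP (- m) h;
  have [?|?] := leP (- m) h'; rewrite ler_norml; apply/andP; split; lra.
Qed.

Lemma clamp_id {R : realType} (m h : R) : `|h| <= m -> clamp m h = h.
Proof.
rewrite ler_norml => /andP[h1 h2]; rewrite /clamp min_r// max_r//.
Qed.

(* Lipschitz approximation of the coordinates of the inverse of [f]. *)
Definition inf_inverse {R : realType} n (f : 'rV[R]_n -> 'rV[R]_n) (L : R)
    (i : 'I_n) (y : 'rV[R]_n) : R :=
  inf [set x 0 i + L * `|y - f x| | x in cube n 1].

Section InfInverse.
Context {R : realType} {n : nat} (f : 'rV[R]_n -> 'rV[R]_n) (L : R) (i : 'I_n).
Hypothesis L0 : 0 <= L.

Lemma inf_inverse_le y x : cube n 1 x ->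
  inf_inverse f L i y <= x 0 i + L * `|y - f x|.
Proof.
move=> Cx; apply: ge_inf; last by exists x.
exists (-1) => _ [z Cz <-]; have := le_trans (rV_norm_coord z i) Cz.
rewrite ler_norml => /andP[h _]; apply: le_trans h _.
by rewrite lerDl mulr_ge0.
Qed.

Lemma inf_inverse_ge y a :
  (forall x, cube n 1 x -> a <= x 0 i + L * `|y - f x|) ->
  a <= inf_inverse f L i y.
Proof.
move=> H; apply: lb_le_inf; last by move=> _ [x Cx <-]; exact: H.
by exists ((0 : 'rV[R]_n) 0 i + L * `|y - f 0|); exists 0 => //=;
  rewrite /cube /= normr0.
Qed.

Lemma inf_inverse_lipschitz y y' :
  `|inf_inverse f L i y - inf_inverse f L i y'| <= L * `|y - y'|.
Proof.
have main z z' : inf_inverse f L i z - L * `|z - z'| <= inf_inverse f L i z'.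
  apply: inf_inverse_ge => x Cx; rewrite lerBlDr.
  apply: le_trans (inf_inverse_le _ Cx) _; rewrite -addrA lerD2l -mulrDr.
  rewrite ler_wpM2l//.
  by have := ler_normD (z - z') (z' - f x); rewrite subrKA [leRHS]addrC.
have := main y y'; have := main y' y; rewrite distrC => h1 h2.
by rewrite ler_norml; apply/andP; split; lra.
Qed.

(** The point [x] itself gives the upper bound. For the lower one, points whose images are within
    [eta] of [f x] have nearby coordinates, and for all others the penalty is at least 2, the
    largest difference of coordinates in the cube. *)
Lemma inf_inverse_approx d eta x : 0 <= d -> 2 <= L * eta -> cube n 1 x ->
  (forall x', cube n 1 x' -> `|f x - f x'| < eta -> `|x - x'| < d) ->
  `|inf_inverse f L i (f x) - x 0 i| <= d.
Proof.
move=> d0 Leta Cx H; have Li : inf_inverse f L i (f x) <= x 0 i.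
  by have := inf_inverse_le (f x) Cx; rewrite subrr normr0 mulr0 addr0.
have : x 0 i - d <= inf_inverse f L i (f x).
  apply: inf_inverse_ge => x' Cx';
    have [lt_eta|ge_eta] := ltP `|f x - f x'| eta.
    have := le_lt_trans (rV_dist_coord x x' i) (H x' Cx' lt_eta).
    rewrite ltr_norml => /andP[_ h].
    have : 0 <= L * `|f x - f x'| by rewrite mulr_ge0.
    by lra.
  have := le_trans (rV_norm_coord x i) Cx;
    have := le_trans (rV_norm_coord x' i) Cx'.
  rewrite !ler_norml => /andP[h1 _] /andP[_ h2].
  have := le_trans Leta (ler_wpM2l L0 ge_eta); lra.
by move=> h; rewrite ler_norml; apply/andP; split; lra.
Qed.

End InfInverse.

(* Otherwise some c near f 0 is missed. An approximate inverse Q of f can be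
   kept away from a small vector s on the sphere around c, hence also on the
   image of f pushed radially off c, and Q - s composed with f would be a map
   near the identity without zero. *)
Lemma image_cube_interior {R : realType} m (f : 'rV[R]_m.+1 -> 'rV[R]_m.+1) :
  {within cube m.+1 1, continuous f} -> {in cube m.+1 1 &, injective f} ->
  exists2 e, 0 < e & forall c, `|c - f 0| < e -> (f @` cube m.+1 1) c.
Proof.
move=> cf fi;
  have C0 : cube m.+1 1 (0 : 'rV[R]_m.+1) by rewrite /cube /= normr0.
have t0 : 0 < 10^-1 :> R by rewrite invr_gt0 ltr0n.
have [eta eta0 Heta] := uniform_inverse cf fi t0.
(* If [f x] lies within [2 * e] of [c], then it lies within [3 * e < eta] of [f 0], so the
   coordinates of [x] are below 1/10. *)
pose e := eta / 4; have e0 : 0 < e by rewrite divr_gt0.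
exists e => // c cf0; apply: contrapT => ncf.
(* For [x] of norm below [d0], [f x] is within [e] of [c]. A zero of the final map with [f x] at
   distance at least [e] from [c] will have norm at most [2 * d < d0], a contradiction. *)
have [d0 d00 Hd0] := within_norm_lt cf C0 (etrans (subr_gt0 _ _) cf0).
pose d := Num.min d0 10^-1 / 3.
have d_gt0 : 0 < d by rewrite divr_gt0// lt_min d00 invr_gt0 ltr0n.
have d3 : 3 * d <= d0 by rewrite /d [3 * _]mulrC divfK ?pnatr_eq0// ge_min lexx.
have d10 : 3 * d <= 10^-1 by rewrite /d [3 * _]mulrC divfK ?pnatr_eq0//
  ge_min lexx orbT.
have [et et0 Het] := uniform_inverse cf fi d_gt0.
pose L := 2 / et; have L0 : 0 < L by rewrite divr_gt0.
have Let : 2 <= L * et by rewrite divfK ?gt_eqF.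
pose H := inf_inverse f L.
have HL i y y' : `|H i y - H i y'| <= L * `|y - y'|.
  by apply: inf_inverse_lipschitz; exact: ltW.
have Happ i x : cube m.+1 1 x -> `|H i (f x) - x 0 i| <= d.
  move=> Cx; apply: (inf_inverse_approx _ _ (ltW d_gt0) Let Cx);
    first exact: ltW.
  by move=> x' Cx'; exact: Het.
pose mu := radial_bound c e.
pose Q (y : 'rV[R]_m.+1) : 'rV[R]_m.+1 := \row_i clamp (mu y) (H i y).
pose Phi := radial_push c e.
have mu_sphere y : `|y - c| = e -> mu y = 10^-1.
  by move=> yc; rewrite /mu /radial_bound yc subrr maxxx mul0r addr0.
have mu0 y : 0 <= mu y.
  by rewrite /mu /radial_bound addr_ge0 ?invr_ge0// divr_ge0 ?(ltW e0)//
    le_max lexx.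
have [|s sd Ps] := @lipschitz_sphere_misses _ _ Q c e L d e0 L0 d_gt0.
  move=> y y' yc y'c; apply/rV_norm_le => [|i];
    first by rewrite mulr_ge0 ?(ltW L0).
  by rewrite !mxE !mu_sphere//;
    apply: le_trans (clamp_lipschitz _ _ _) (HL _ _ _).
have s_i i : `|s 0 i| <= d by exact: le_trans (rV_norm_coord _ _) sd.
pose h x := Q (Phi (f x)) - s.
have fc x : cube m.+1 1 x -> 0 < `|f x - c|.
  move=> Cx; rewrite normr_gt0 subr_eq0; apply/eqP => fxc; apply: ncf.
  by exists x.
have Phi_far y : e <= `|y - c| -> Phi y = y.
  move=> ey; rewrite /Phi /radial_push max_r;
    first by rewrite scale1r addrC subrK.
  by rewrite ler_pdivrMr ?mul1r// (lt_le_trans e0).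
have Phi_near y : 0 < `|y - c| -> `|y - c| <= e -> `|Phi y - c| = e.
  move=> yc ye; rewrite /Phi /radial_push addrC addKr max_l.
    by rewrite normrZ [ `|e / _| ]ger0_norm ?divfK ?gt_eqF// divr_ge0// ltW.
  by rewrite ler_pdivlMr// mul1r.
have small x : cube m.+1 1 x -> `|f x - c| < 2 * e -> forall i,
  `|x 0 i| < 10^-1.
  move=> Cx fxc i; apply: le_lt_trans (rV_norm_coord _ _) _.
  rewrite -[x]subr0; apply: Heta => //; rewrite -(subrKA c).
  apply: le_lt_trans (ler_normD _ _) _; move: cf0 fxc; rewrite /e; lra.
have hQ x i : cube m.+1 1 x -> e <= `|f x - c| -> `|Q (f x) 0 i - x 0 i| <= d.
  move=> Cx fxc; have xmu : `|x 0 i| <= mu (f x).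
    have [lt2|ge2] := ltP `|f x - c| (2 * e).
      apply: le_trans (ltW (small _ Cx lt2 i)) _.
      by rewrite /mu /radial_bound lerDl divr_ge0 ?(ltW e0)// le_max lexx.
    apply: le_trans (le_trans (rV_norm_coord _ _) Cx) _.
    rewrite /mu /radial_bound -[leLHS]add0r lerD ?invr_ge0// ler_pdivlMr//
      mul1r le_max.
    by apply/orP; right; lra.
  rewrite mxE -[x 0 i in X in X <= _](clamp_id xmu).
  exact: le_trans (clamp_lipschitz _ _ _) (Happ _ _ Cx).
have ch : {within cube m.+1 1, continuous h}.
  apply/subspace_continuousP => x Cx.
  have cQPhi : {for f x, continuous (fun y => Q (Phi y) - s)}.
    apply: (@continuousB _ _ _ (Q \o Phi) (fun=> s));
      last exact: cst_continuous.
    apply: continuous_comp; first by apply: radial_push_continuous;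
      rewrite -subr_eq0 -normr_gt0 fc.
    apply: continuous_rV => i.
    rewrite (_ : (fun y => _) = fun y => clamp (mu y) (H i y)); last first.
      by apply/funext => y; rewrite mxE.
    have cmu : {for Phi (f x), continuous mu} by exact: radial_bound_continuous.
    have cH : {for Phi (f x), continuous (H i)} by
      exact: (lipschitz_continuous L0 (HL i)).
    apply: (@continuous_max _ _ (fun y => - mu y) (fun y =>
      Num.min (mu y) (H i y))).
      by apply: continuousN.
    by apply: (@continuous_min _ _ mu (H i)).
  apply: cvg_trans cQPhi => /=.
  have /subspace_continuousP/(_ _ Cx) := cf.
  by move=> /(@cvg_app _ _ _ _ (fun y => Q (Phi y) - s)).
(* Far from [c] the map [h] differs from the identity by at most [2 * d]; near [c] the coordinates
   of [x] and of the clamped inverse are at most 1/10, and those of [s] at most [d]. *)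
have [x i Cx|x Cx] := near_identity_zero ch.
  rewrite /h !mxE; have [fxc|fxc] := leP e `|f x - c|.
    have := hQ x i Cx fxc; rewrite Phi_far// mxE; have := s_i i.
    rewrite !ler_norml ltr_norml => /andP[a1 a2] /andP[b1 b2].
    by apply/andP; split; lra.
  have := @clamp_norm R _ (H i (Phi (f x))) (mu0 (Phi (f x))).
  rewrite (mu_sphere _ (Phi_near _ (fc _ Cx) (ltW fxc))).
  have e2 : e < 2 * e by lra.
  have := s_i i; have := small x Cx (lt_trans fxc e2) i.
  rewrite ltr_norml => /andP[b1 b2]; rewrite ler_norml => /andP[a1 a2].
  rewrite ler_norml => /andP[c1 c2].
  by rewrite ltr_norml; apply/andP; split; lra.
rewrite /h => /eqP; rewrite subr_eq0 => /eqP hx0.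
have [fxc|fxc] := leP e `|f x - c|; last first.
  exact: Ps (Phi_near _ (fc _ Cx) (ltW fxc)) hx0.
rewrite Phi_far// in hx0.
have xd0 : `|x| < d0.
  apply/rV_norm_lt => // i; have := hQ x i Cx fxc; rewrite hx0; have := s_i i.
  by rewrite !ler_norml ltr_norml => /andP[a1 a2] /andP[b1 b2]; apply/andP;
    split; lra.
have := Hd0 x Cx; rewrite sub0r normrN => /(_ xd0).
have := ler_normD (f 0 - f x) (f x - c); rewrite subrKA.
have := ler_normD (f x - f 0) (f 0 - c); rewrite subrKA.
rewrite (distrC (f 0) (f x)) (distrC (f 0) c); lra.
Qed.

Lemma invariance_of_domain {R : realType} m (U : set 'rV[R]_m.+1)
    (f : 'rV[R]_m.+1 -> 'rV[R]_m.+1) :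
  open U -> {within U, continuous f} -> {in U &, injective f} ->
  open (f @` U).
Proof.
move=> oU cf fi; rewrite openE => _ [x Ux <-].
have : nbhs x U by exact: open_nbhs_nbhs.
move=> /nbhs_ballP[r r0]; rewrite -ball_normE => rU.
have r20 : 0 < r / 2 by exact: divr_gt0.
pose a (v : 'rV[R]_m.+1) := x + (r / 2) *: v.
have aU v : cube m.+1 1 v -> U (a v).
  move=> Cv; apply: rU; rewrite /= /a opprD addNKr normrN normrZ gtr0_norm//.
  apply: (@le_lt_trans _ _ (r / 2));
    last by rewrite ltr_pdivrMr// ltr_pMr// ltr1n.
  by rewrite ler_piMr// ltW.
have ca : continuous a.
  move=> v; apply: (@continuousD _ _ _ (fun=> x) (fun v : 'rV[R]_m.+1 =>
    (r / 2) *: v)).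
    exact: cst_continuous.
  exact: scaler_continuous.
have [| |e e0 He] := @image_cube_interior _ _ (f \o a).
- apply/subspace_continuousP => v Cv.
  move/subspace_continuousP/(_ _ (aU _ Cv)) : cf => cf A /cf /=.
  rewrite !withinE => -[B Ba BU].
  exists (a @^-1` B); first exact: ca.
  rewrite eqEsubset; split=> z [/= Az Cz]; split=> //.
    have : (f @^-1` A `&` U) (a z) by split=> //; exact: aU.
    by rewrite BU => -[].
  have : (B `&` U) (a z) by split=> //; exact: aU.
  by rewrite -BU => -[].
- move=> v w /set_mem Cv /set_mem Cw /= /fi;
  rewrite !inE => /(_ (aU _ Cv) (aU _ Cw)).
  by move=> /addrI/scalerI; apply; rewrite gt_eqF.
apply/nbhs_ballP; exists e => // c; rewrite -ball_normE /= distrC => cf0.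
have [|v Cv <-] := He c; first by rewrite /= /a scaler0 addr0.
by exists (a v) => //; exact: aU.
Qed.

(** * Euclidean disks and spheres *)

Section WithinComp.
Context {T U V : topologicalType}.

Lemma within_comp (A : set T) (B : set U) (f : T -> U) (g : U -> V) :
  (forall x, A x -> B (f x)) -> {within A, continuous f} ->
  {within B, continuous g} -> {within A, continuous (g \o f)}.
Proof.
move=> AB /subspace_continuousP cf /subspace_continuousP cg.
apply/subspace_continuousP => x Ax W /(cg _ (AB _ Ax)) /=.
rewrite !withinE => -[N Nfx NB]; have := cf _ Ax _ Nfx.
rewrite /= withinE => -[M Mx MA]; exists M => //.
rewrite -MA eqEsubset; split=> y [/= Wy Ay]; split=> //.
  have : (g @^-1` W `&` B) (f y) by split=> //; exact: AB.
  by rewrite NB => -[].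
have : (N `&` B) (f y) by split=> //; exact: AB.
by rewrite -NB => -[].
Qed.

Lemma within_preimage_closed (A : set T) (f : T -> U) (K : set U) :
  closed A -> {within A, continuous f} -> closed K -> closed (A `&` f @^-1` K).
Proof.
move=> cA /continuous_closedP cf /cf /closed_subspaceP[F cF FA].
by rewrite setIC -FA; exact: closedI.
Qed.

End WithinComp.

Section EuclideanNorm.
Context {R : realType} {n : nat}.
Implicit Types (v : 'rV[R]_n) (a : R).

Definition enorm v : R := Num.sqrt (\sum_(i < n) v 0 i ^+ 2).

Lemma sum_sqr_ge0 v : 0 <= \sum_(i < n) v 0 i ^+ 2.
Proof. by apply: sumr_ge0 => i _; exact: sqr_ge0. Qed.

Lemma enorm_ge0 v : 0 <= enorm v. Proof. exact: sqrtr_ge0. Qed.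

Lemma enorm_sqr v : enorm v ^+ 2 = \sum_(i < n) v 0 i ^+ 2.
Proof. by rewrite sqr_sqrtr ?sum_sqr_ge0. Qed.

Lemma enormZ a v : enorm (a *: v) = `|a| * enorm v.
Proof.
rewrite /enorm -sqrtr_sqr -sqrtrM ?sqr_ge0// mulr_sumr.
by congr Num.sqrt; apply: eq_bigr => i _; rewrite mxE exprMn.
Qed.

Lemma enorm_eq0 v : enorm v = 0 -> v = 0.
Proof.
move=> v0; apply/rowP => i; rewrite mxE.
have /eqP : \sum_(i < n) v 0 i ^+ 2 = 0 by rewrite -enorm_sqr v0 expr0n.
rewrite psumr_eq0 => [/allP/(_ i)|j _]; last exact: sqr_ge0.
by rewrite mem_index_enum => /(_ isT); rewrite sqrf_eq0 => /eqP.
Qed.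

Lemma enorm0 : enorm 0 = 0.
Proof. by rewrite -(scale0r (0 : 'rV[R]_n)) enormZ normr0 mul0r. Qed.

Lemma diskE v : @disk R n v <-> enorm v <= 1.
Proof.
rewrite /disk /= -enorm_sqr -[X in _ <= X](expr1n _ 2).
by rewrite ler_pXn2r ?nnegrE ?enorm_ge0.
Qed.

Lemma odiskE v : @odisk R n v <-> enorm v < 1.
Proof.
rewrite /odisk /= -enorm_sqr -[X in _ < X](expr1n _ 2).
by rewrite ltr_pXn2r ?nnegrE ?enorm_ge0.
Qed.

Lemma sphereE v : @sphere R n v <-> enorm v = 1.
Proof.
rewrite /sphere /= -enorm_sqr; split=> [v1|->]; last by rewrite expr1n.
by apply/eqP; rewrite -(@eqrXn2 _ 2) ?enorm_ge0// v1 expr1n.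
Qed.

Lemma odisk_disk v : @odisk R n v -> @disk R n v.
Proof. by rewrite odiskE diskE => /ltW. Qed.

Lemma sphere_disk v : @sphere R n v -> @disk R n v.
Proof. by rewrite sphereE diskE => ->. Qed.

Lemma disk_cases v : @disk R n v -> @odisk R n v \/ @sphere R n v.
Proof.
by rewrite odiskE diskE sphereE le_eqVlt => /orP[/eqP|]; [right|left].
Qed.

Lemma sum_sqr_continuous :
  continuous (fun v : 'rV[R]_n => \sum_(i < n) v 0 i ^+ 2).
Proof.
apply: continuous_big => [|i _ v]; first exact: add_continuous.
apply: (@continuous_comp _ _ _ (fun v : 'rV[R]_n => v 0 i) (fun x => x ^+ 2)).
  exact: continuous_coord.
exact: exprn_continuous.
Qed.

Lemma enorm_continuous : continuous enorm.
Proof.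
move=> v; apply: (@continuous_comp _ _ _ _ Num.sqrt).
  exact: sum_sqr_continuous.
exact: sqrt_continuous.
Qed.

Lemma disk_closed : closed (@disk R n).
Proof.
apply: (@closed_comp _ _ (fun v : 'rV[R]_n => \sum_(i < n) v 0 i ^+ 2)
  [set r | r <= 1]).
  by move=> x _; exact: sum_sqr_continuous.
exact: closed_le.
Qed.

Lemma sphere_closed : closed (@sphere R n).
Proof.
apply: (@closed_comp _ _ (fun v : 'rV[R]_n => \sum_(i < n) v 0 i ^+ 2)
  [set r | r = 1]).
  by move=> x _; exact: sum_sqr_continuous.
exact: closed_eq.
Qed.

Lemma odisk_open : open (@odisk R n).
Proof.
apply: (@open_comp _ _ (fun v : 'rV[R]_n => \sum_(i < n) v 0 i ^+ 2)
  [set r | r < 1]).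
  by move=> x _; exact: sum_sqr_continuous.
exact: open_lt.
Qed.

Lemma coord_le_enorm v i : `|v 0 i| <= enorm v.
Proof.
rewrite -sqrtr_sqr ler_wsqrtr// (bigD1 i)//= lerDl.
by apply: sumr_ge0 => j _; exact: sqr_ge0.
Qed.

Lemma disk_compact : compact (@disk R n).
Proof.
apply: (subclosed_compact disk_closed (@compact_cube R n 1)) => v /diskE v1.
by apply/rV_norm_le => // i; exact: le_trans (coord_le_enorm _ _) v1.
Qed.

Lemma sphere_compact : compact (@sphere R n).
Proof.
by apply: (subclosed_compact sphere_closed disk_compact) => v;
  exact: sphere_disk.
Qed.

Lemma scale_continuous_l v : continuous (fun t : R => t *: v).
Proof.
move=> t; apply: (@continuousZ R _ _ id (fun=> v)); first exact: cvg_id.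
exact: cst_continuous.
Qed.

Lemma odisk_scale v t : @disk R n v -> `|t| < 1 -> @odisk R n (t *: v).
Proof.
rewrite odiskE diskE enormZ => v1 t1; apply: le_lt_trans t1.
by rewrite ler_piMr.
Qed.

Lemma odisk_dense (K : set 'rV[R]_n) :
  closed K -> @odisk R n `<=` K -> @disk R n `<=` K.
Proof.
move=> cK oK v dv; apply: cK => N Nv.
have : nbhs (1 : R) ((fun t : R => t *: v) @^-1` N).
  by apply: scale_continuous_l; rewrite scale1r.
move=> /nbhs_ballP[e e0]; rewrite -ball_normE => He.
pose t := 1 - Num.min (e / 2) 2^-1.
have m0 : 0 < Num.min (e / 2) 2^-1 by rewrite lt_min divr_gt0//= invr_gt0.
have m2 : Num.min (e / 2) 2^-1 <= 2^-1 by rewrite ge_min lexx orbT.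
have me : Num.min (e / 2) 2^-1 < e.
  by apply: (@le_lt_trans _ _ (e / 2));
    rewrite ?ge_min ?lexx// ltr_pdivrMr// ltr_pMr// ltr1n.
exists (t *: v); split.
  apply: oK; apply: odisk_scale => //.
  rewrite ger0_norm /t; lra.
apply: He; rewrite /= /t opprB addrC subrK.
by rewrite gtr0_norm.
Qed.

(** By convexity any point of the disk is joined to a point of [A] by a segment, on which the trace
    of [A] is open and closed. *)
Lemma odisk_connected (A : set 'rV[R]_n) :
  A !=set0 -> A `<=` @odisk R n -> open A ->
  (exists2 K, closed K & A = @odisk R n `&` K) -> A = @odisk R n.
Proof.
move=> [a Aa] Ao oA [K cK AK]; rewrite eqEsubset; split=> // b ob.
pose p (t : R) := a + t *: (b - a).
have cp : continuous p.
  move=> t; apply: (@continuousD _ _ _ (fun=> a) (fun t : R => t *: (b - a))).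
    exact: cst_continuous.
  exact: scale_continuous_l.
have po t : `[0, 1]%classic t -> @odisk R n (p t).
  rewrite /= in_itv /= => /andP[t0 t1]; rewrite /odisk /=.
  have oa := Ao _ Aa; rewrite /odisk /= in oa ob.
  apply: (@le_lt_trans _ _
    ((1 - t) * (\sum_i a 0 i ^+ 2) + t * \sum_i b 0 i ^+ 2)).
    rewrite !mulr_sumr -big_split /=; apply: ler_sum => i _.
    rewrite /p !mxE; have : 0 <= t * (1 - t) * (a 0 i - b 0 i) ^+ 2.
      by rewrite mulr_ge0 ?sqr_ge0// mulr_ge0// subr_ge0.
    by rewrite -subr_ge0; congr (0 <= _); ring.
  have [->|t_neq0] := eqVneq t 0; first by rewrite subr0 mul1r mul0r addr0.
  have tp : 0 < t by rewrite lt_neqAle eq_sym t_neq0.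
  nra.
have c01 : connected `[0, 1 : R]%classic by apply/connected_intervalP;
  exact: interval_is_interval.
have E : `[0, 1]%classic `&` p @^-1` A = `[0, 1]%classic.
  apply: c01.
  - by exists 0; split=> /=; rewrite ?in_itv/= ?lexx ?ler01// /p scale0r addr0.
  - by exists (p @^-1` A) => //; apply: open_comp => // t _; exact: cp.
  - exists (p @^-1` K); first by apply: closed_comp => // t _; exact: cp.
    rewrite eqEsubset AK; split=> t [/= t01 Ht]; first by split=> //; case: Ht.
    by split=> //; split=> //; exact: po.
have : `[0, 1]%classic (1 : R) by rewrite /= in_itv /= lexx ler01.
by rewrite -E => -[_]; rewrite /p /= scale1r addrC subrK.
Qed.

Definition unit_dir v : 'rV[R]_n := (enorm v)^-1 *: v.

Lemma enorm_neq0 v : v != 0 -> enorm v != 0.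
Proof. by apply: contra_neq; exact: enorm_eq0. Qed.

Lemma unit_dir_sphere v : v != 0 -> @sphere R n (unit_dir v).
Proof.
by move=> /enorm_neq0 v0;
  rewrite sphereE enormZ ger0_norm ?invr_ge0 ?enorm_ge0// mulVf.
Qed.

Lemma unit_dir_id v : @sphere R n v -> unit_dir v = v.
Proof. by rewrite sphereE /unit_dir => ->; rewrite invr1 scale1r. Qed.

Lemma unit_dirZ t v : 0 < t -> @sphere R n v -> unit_dir (t *: v) = v.
Proof.
rewrite sphereE /unit_dir enormZ => t0 ->.
by rewrite mulr1 gtr0_norm// scalerA mulVf ?scale1r// gt_eqF.
Qed.

Lemma unit_dirK v : enorm v *: unit_dir v = v.
Proof.
have [->|/enorm_neq0 v0] := eqVneq v 0; first by rewrite enorm0 scale0r.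
by rewrite /unit_dir scalerA divff// scale1r.
Qed.

Lemma sphere_neq0 v : @sphere R n v -> v != 0.
Proof. by rewrite sphereE; apply: contra_eq_neq => ->;
  rewrite enorm0 eq_sym oner_eq0. Qed.

Lemma unit_dir_continuous v : v != 0 -> {for v, continuous unit_dir}.
Proof.
move=> /enorm_neq0 v0.
apply: (@continuousZ _ _ _ (fun v => (enorm v)^-1) id); last exact: cvg_id.
exact: (cvgV v0 (@enorm_continuous v)).
Qed.

Lemma rV_neq0_open : open [set v : 'rV[R]_n | v != 0].
Proof.
rewrite (_ : mkset _ = [set v | 0 < enorm v]).
  apply: (@open_comp _ _ enorm [set r | 0 < r]); last exact: open_gt.
  by move=> ? _; exact: enorm_continuous.
rewrite eqEsubset; split=> v /=.
  by move=> /enorm_neq0 v0; rewrite lt_neqAle eq_sym v0 enorm_ge0.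
by apply: contraTneq => ->; rewrite enorm0 ltxx.
Qed.

End EuclideanNorm.

(** Indexing by natural numbers embeds the vectors of dimension [k] in every larger dimension by
    zeros, without casts. *)
Definition pad_coord {R : realType} k (w : 'rV[R]_k) (j : nat) : R :=
  if insub j is Some j' then w 0 j' else 0.

Lemma pad_coord_continuous {R : realType} k j :
  continuous (fun w : 'rV[R]_k => pad_coord w j).
Proof.
rewrite /pad_coord; case: insub => [j'|]; first exact: continuous_coord.
by move=> w; exact: cst_continuous.
Qed.

(* Coning off turns a map from a patch of the sphere into one from an open set
   of the same dimension as the target, so that no charts are needed. *)
Lemma sphere_patch_open {R : realType} n k (Y : topologicalType)
    (f : 'rV[R]_n -> Y) (g : 'rV[R]_k -> Y) (g' : Y -> 'rV[R]_k) (V :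
      set 'rV[R]_n) :
  (k < n)%N -> open V ->
  {within @sphere R n, continuous f} ->
  (forall v w, @sphere R n v -> @sphere R n w -> f v = f w -> v = w) ->
  {within g @` @disk R k, continuous g'} ->
  (forall w, @disk R k w -> g' (g w) = w) ->
  (forall v, @sphere R n v -> V v -> (g @` @odisk R k) (f v)) ->
  (exists2 v, @sphere R n v & V v) ->
  n = k.+1 /\
  open [set w | @odisk R k w /\ exists v, [/\ @sphere R n v, V v & f v = g w]].
Proof.
case: n f V => // m f V km oV cf fi cg' gK fV [v0 S0 V0].
pose U := [set v : 'rV[R]_m.+1 | v != 0 /\ V (unit_dir v)].
have oU : open U.
  rewrite openE => v [v_neq0 Vv].
  have h1 : \forall w \near v, V (unit_dir w).
    by apply: (unit_dir_continuous v_neq0); apply: open_nbhs_nbhs.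
  have h2 : \forall w \near v, w != 0.
    by apply: open_nbhs_nbhs; split=> //; exact: rV_neq0_open.
  by near=> w; split; near: w.
pose phi v := g' (f (unit_dir v)).
have phiP v : U v -> @odisk R k (phi v) /\ g (phi v) = f (unit_dir v).
  move=> [v_neq0 Vv]; have [w ow gw] := fV _ (unit_dir_sphere v_neq0) Vv.
  by rewrite /phi -gw gK//; exact: odisk_disk.
(* Cone coordinates: the radius of [v], then the image of its direction, padded by zeros. *)
pose F (v : 'rV[R]_m.+1) : 'rV[R]_m.+1 :=
  \row_i (if unlift ord0 i is Some j then pad_coord (phi v) j else enorm v).
have F0 v : F v 0 ord0 = enorm v by rewrite mxE unlift_none.
have FS v j : F v 0 (lift ord0 j) = pad_coord (phi v) j by rewrite mxE liftK.
have cphi : {within U, continuous phi}.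
  apply: (@within_comp _ _ _ U (@sphere R m.+1 `&` V) unit_dir (g' \o f)).
  - by move=> v [v_neq0 Vv]; split=> //; exact: unit_dir_sphere.
  - apply: continuous_in_subspaceT => v /set_mem[v_neq0 _];
    exact: unit_dir_continuous.
  - apply: (@within_comp _ _ _ _ (g @` @disk R k)) => //.
      move=> v [Sv Vv]; have [w ow <-] := fV _ Sv Vv.
      by exists w => //; exact: odisk_disk.
    by apply: continuous_subspaceW cf; exact: subIsetl.
have cF : {within U, continuous F}.
  rewrite continuous_open_subspace// => v vU; apply: continuous_rV => i.
  have [j ->|->] := unliftP ord0 i.
    rewrite (_ : (fun y => _) = (fun w => pad_coord w j) \o phi); last first.
      by apply/funext => w; rewrite /= FS.
    apply: continuous_comp; last exact: pad_coord_continuous.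
    by move: vU; rewrite continuous_open_subspace// in cphi => /cphi.
  rewrite (_ : (fun y => _) = @enorm R m.+1); first exact: enorm_continuous.
  by apply/funext => w; rewrite F0.
have pad_inj (w w' : 'rV[R]_k) :
    (forall j : 'I_m, pad_coord w j = pad_coord w' j) -> w = w'.
  move=> H; apply/rowP => j;
    have jm : (j < m)%N by exact: leq_trans (ltn_ord j) km.
  by have := H (Ordinal jm); rewrite /pad_coord /= valK.
have Finj : {in U &, injective F}.
  move=> v w /set_mem Uv /set_mem Uw FE.
  have vw : phi v = phi w.
    by apply: pad_inj => j; rewrite -!FS FE.
  have [_ gv] := phiP v Uv; have [_ gw] := phiP w Uw.
  rewrite -(unit_dirK v) -(unit_dirK w) -!F0 FE; congr (_ *: _).
  by apply: fi;
    [exact: unit_dir_sphere Uv.1|exact: unit_dir_sphere Uw.1|rewrite -gv -gw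
    vw].
have oF := invariance_of_domain oU cF Finj.
have Uv0 : U v0 by split; [exact: sphere_neq0|rewrite unit_dir_id].
(* If [k < m], a padded coordinate of [F] vanishes identically, so its image contains no ball,
   although it is open. *)
have mk : m = k.
  apply/eqP; rewrite eqn_leq -[(k <= m)%N]ltnS km andbT leqNgt;
    apply/negP => ltkm.
  pose l := lift ord0 (Ordinal ltkm).
  have : nbhs (F v0) (F @` U) by apply: open_nbhs_nbhs; split=> //; exists v0.
  move=> /nbhs_ballP[e e0];
    rewrite -ball_normE => /(_ (F v0 + (e / 2) *: delta_mx 0 l)) [].
    rewrite /= opprD addNKr normrN normrZ gtr0_norm ?divr_gt0//.
    apply: (@le_lt_trans _ _ (e / 2));
      last by rewrite ltr_pdivrMr// ltr_pMr// ltr1n.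
    apply: ler_piMr; first by rewrite ltW// divr_gt0.
    apply/rV_norm_le => // i.
    by rewrite mxE eqxx /=; case: eqP; rewrite ?normr1 ?normr0.
  have Fl v : F v 0 l = 0 by rewrite FS /pad_coord insubN//= ltnn.
  move=> v _ /rowP/(_ l); rewrite !mxE -/l !eqxx mulr1 => /eqP.
  have := Fl v; have := Fl v0; rewrite !mxE => -> ->.
  by rewrite add0r eq_sym gt_eqF// divr_gt0.
split; first by rewrite mk.
subst m.
have padE (w : 'rV[R]_k) (j : 'I_k) : pad_coord w j = w 0 j.
  by rewrite /pad_coord valK.
(* The slice at radius 1: [w] comes from the patch exactly when [cone w] is a value of [F] on
   [U]. *)
pose cone (w : 'rV[R]_k) : 'rV[R]_k.+1 :=
  \row_i (if unlift ord0 i is Some j then w 0 j else 1).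
have ccone : continuous cone.
  move=> w; apply: continuous_rV => i.
  have [j ->|->] := unliftP ord0 i.
    rewrite (_ : (fun y => _) = fun w : 'rV[R]_k => w 0 j);
      first exact: continuous_coord.
    by apply/funext => y; rewrite mxE liftK.
  rewrite (_ : (fun y => _) = fun=> 1); first exact: cst_continuous.
  by apply/funext => y; rewrite mxE unlift_none.
rewrite (_ : mkset _ = @odisk R k `&` cone @^-1` (F @` U)).
  apply: openI; first exact: odisk_open.
  by apply: open_comp => // w _; exact: ccone.
rewrite eqEsubset; split=> w [ow /=].
  move=> [v [Sv Vv fv]]; split=> //; exists v.
    by split; [exact: sphere_neq0|rewrite unit_dir_id].
  have phiv : phi v = w by rewrite /phi unit_dir_id// fv gK//;
    exact: odisk_disk.
  apply/rowP => i; have [j ->|->] := unliftP ord0 i.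
    by rewrite FS phiv padE mxE liftK.
  by rewrite F0 mxE unlift_none; apply/sphereE.
move=> [v Uv FE]; split=> //; exists v.
have Sv : @sphere R k.+1 v by rewrite sphereE -F0 FE mxE unlift_none.
have phiv : phi v = w.
  by apply/rowP => j; rewrite -padE -FS FE mxE liftK.
have [_] := phiP v Uv; rewrite phiv unit_dir_id// => ->.
by case: Uv => _; rewrite unit_dir_id.
Unshelve. all: by end_near. Qed.

Lemma closed_bigcup_finite (T : topologicalType) (I : Type) (A : set I)
    (F : I -> set T) : finite_set A -> (forall i, A i -> closed (F i)) ->
  closed (\bigcup_(i in A) F i).
Proof.
move=> fA cF; rewrite -(bigcup_image A F id).
by apply: closed_bigcup => [|_ [i Ai <-]]; [exact: finite_image|exact: cF].
Qed.

(** * Closed cells are unions of cells *)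

Section Cells.
Context {R : realType} (X : regularCW R).
Local Notation dim := (@cw_dim R X).
Local Notation chi c := (@cw_char R X c).
Implicit Types (c d e : cw_index X) (x : X).

Definition cell c : set X := chi c @` @disk R (dim c).
Definition ocell c : set X := chi c @` @odisk R (dim c).
Definition bcell c : set X := chi c @` @sphere R (dim c).

Definition cell_inv c : X -> 'rV[R]_(dim c) := projT1 (cid (cw_embedding c).2).

Lemma char_continuous c : {within @disk R (dim c), continuous (chi c)}.
Proof. exact: (cw_embedding c).1. Qed.

Lemma cell_inv_continuous c : {within cell c, continuous (cell_inv c)}.
Proof. by rewrite /cell_inv; case: cid => g []. Qed.

Lemma cell_invK c v : @disk R (dim c) v -> cell_inv c (chi c v) = v.
Proof. by rewrite /cell_inv; case: cid => g /= [_]; exact. Qed.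

Lemma char_inj c v w : @disk R (dim c) v -> @disk R (dim c) w ->
  chi c v = chi c w -> v = w.
Proof. by move=> dv dw vw; rewrite -(cell_invK dv) vw cell_invK. Qed.

Lemma cell_compact c : compact (cell c).
Proof. exact: continuous_compact (@char_continuous c) disk_compact. Qed.

Lemma cell_closed c : closed (cell c).
Proof. exact: compact_closed (@cw_hausdorff R X) (@cell_compact c). Qed.

Lemma bcell_closed c : closed (bcell c).
Proof.
apply: (compact_closed (@cw_hausdorff R X)).
apply: continuous_compact sphere_compact.
by apply: continuous_subspaceW (@char_continuous c) => v; exact: sphere_disk.
Qed.

Lemma char_preimage_closed c (K : set X) : closed K ->
  closed (@disk R (dim c) `&` chi c @^-1` K).
Proof. exact: within_preimage_closed disk_closed (@char_continuous c). Qed.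

Lemma ocell_cell c : ocell c `<=` cell c.
Proof. by move=> _ [v ov <-]; exists v => //; exact: odisk_disk. Qed.

Lemma bcell_cell c : bcell c `<=` cell c.
Proof. by move=> _ [v ov <-]; exists v => //; exact: sphere_disk. Qed.

Lemma cell_cases c x : cell c x -> ocell c x \/ bcell c x.
Proof. by move=> [v /disk_cases[dv|dv] <-]; [left|right]; exists v. Qed.

Lemma bcell_lower c d x : bcell c x -> ocell d x -> (dim d < dim c)%N.
Proof.
move=> bx dx; have [D [_ Dlt Dcov]] := cw_boundary c.
have [e De ex] := Dcov x bx.
by rewrite (@cw_disjoint _ _ d e x dx ex); exact: Dlt.
Qed.

Lemma cell_ocell c d x : cell c x -> ocell d x -> d = c \/ (dim d < dim c)%N.
Proof.
move=> /cell_cases[cx|bx] dx; [left|right]; last exact: bcell_lower bx dx.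
exact: cw_disjoint dx cx.
Qed.

(** When no open cell met by the patch exceeds [d] in dimension, the other cells are cut off by
    removing finitely many closed cells, none of which meets the open cell [d], for dimension
    reasons. *)
Lemma sphere_patch c d (V : set 'rV[R]_(dim c)) : open V ->
  (forall v e, @sphere R (dim c) v -> V v -> ocell e (chi c v) ->
    (dim e <= dim d)%N) ->
  exists2 V', open V' & forall v, @sphere R (dim c) v ->
    (V' v <-> V v /\ ocell d (chi c v)).
Proof.
move=> oV Vd; have [D [finD Dlt Dcov]] := cw_boundary c.
pose D' := [set e | D e /\ (e <> d /\ (dim e <= dim d)%N)].
have finD' : finite_set D' by apply: sub_finite_set finD => e [].
have cK : closed (\bigcup_(e in D') cell e).
  by apply: closed_bigcup_finite => // e _; exact: cell_closed.
exists (V `&` ~` (@disk R (dim c) `&` chi c @^-1` (\bigcup_(e in D') cell e))).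
  by apply: openI => //; apply: closed_openC; exact: char_preimage_closed.
move=> v Sv; split=> [[Vv nK]|[Vv dv]]; split=> //.
  have [e De ev] : (\bigcup_(e in D) ocell e) (chi c v) by apply: Dcov;
    exists v.
  have [<-//|ed] := pselect (e = d).
  exfalso; apply: nK; split; first exact: sphere_disk.
  exists e; last exact: ocell_cell.
  by split=> //; split=> //; exact: Vd ev.
move=> [_ [e [De [ed le_ed]] ev]].
have [/esym//|] := cell_ocell ev dv.
by rewrite ltnNge le_ed.
Qed.

Lemma sphere_patch_top c d (V : set 'rV[R]_(dim c)) : open V ->
  (forall v e, @sphere R (dim c) v -> V v -> ocell e (chi c v) ->
    (dim e <= dim d)%N) ->
  (exists v, [/\ @sphere R (dim c) v, V v & ocell d (chi c v)]) ->
  dim c = (dim d).+1 /\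
  open [set w | @odisk R (dim d) w /\
    exists v, [/\ @sphere R (dim c) v, V v & chi c v = chi d w]].
Proof.
move=> oV Vd [v0 [S0 V0 d0]]; have [V' oV' HV'] := sphere_patch oV Vd.
have dcd : (dim d < dim c)%N by apply: (@bcell_lower c d (chi c v0)) => //;
  exists v0.
have [||||||cd oW] := @sphere_patch_open R (dim c) (dim d) X (chi c) (chi d)
    (cell_inv d) V' dcd oV'.
- by apply: continuous_subspaceW (@char_continuous c) => v; exact: sphere_disk.
- by move=> v w Sv Sw; apply: char_inj; exact: sphere_disk.
- exact: cell_inv_continuous.
- exact: cell_invK.
- by move=> v Sv /(HV' _ Sv)[].
- by exists v0 => //; apply/(HV' _ S0).
split=> //; move: oW; congr open; rewrite eqEsubset;
  split=> w [ow [v [Sv Vv vw]]].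
  by split=> //; exists v; split=> //; have [] := (HV' _ Sv).1 Vv.
split=> //; exists v; split=> //; apply/(HV' _ Sv); split=> //.
by rewrite vw; exists w.
Qed.

(** Among the open cells met by the patch, one of maximal dimension must have codimension one, by
    invariance of domain. *)
Lemma facet_dense c (V : set 'rV[R]_(dim c)) v : open V ->
  @sphere R (dim c) v ->
  V v -> exists d w, [/\ dim c = (dim d).+1, @sphere R (dim c) w, V w &
    ocell d (chi c w)].
Proof.
move=> oV Sv Vv.
pose P k := `[< exists d w, [/\ dim d = k, @sphere R (dim c) w,
  V w & ocell d (chi c w)] >].
have exP : exists k, P k.
  have [d dv] := cw_cover (chi c v).
  by exists (dim d); apply/asboolP; exists d, v.
have ubP k : P k -> (k <= dim c)%N.
  move=> /asboolP[d [w [<- Sw _ dw]]]; apply: ltnW.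
  by apply: bcell_lower dw; exists w.
case: (ex_maxnP exP ubP) => k /asboolP[d [w [dk Sw Vw dw]]] maxk.
have [|cd _] := @sphere_patch_top c d V oV _ (ex_intro _ w (And3 Sw Vw dw)).
  move=> v' e Sv' Vv' ev'; rewrite dk; apply: maxk; apply/asboolP.
  by exists e, v'.
by exists d, w.
Qed.

(** The part of the open cell [d] that lies in the boundary of [c] is open by invariance of domain
    and closed by compactness of the sphere, hence everything by connectedness. *)
Lemma facet_sub_boundary c d : dim c = (dim d).+1 ->
  (exists2 v, @sphere R (dim c) v & ocell d (chi c v)) -> ocell d `<=` bcell c.
Proof.
move=> cd [v0 S0 d0].
have [||_ oW] := @sphere_patch_top c d setT openT.
- move=> v e Sv _ ev; rewrite -ltnS -cd.
  by apply: bcell_lower ev; exists v.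
- by exists v0.
set W := [set w | _] in oW.
have WE : W = @odisk R (dim d) `&` (@disk R (dim d) `&` chi d @^-1` bcell c).
  rewrite eqEsubset; split=> w.
    move=> [ow [v [Sv _ vw]]]; split=> //; split; first exact: odisk_disk.
    by exists v.
  by move=> [ow [_ [v Sv vw]]]; split=> //; exists v.
have Wodisk : W = @odisk R (dim d).
  apply: odisk_connected => //.
  - by have [w ow wv] := d0; exists w; split=> //; exists v0.
  - by move=> w [].
  - exists (@disk R (dim d) `&` chi d @^-1` bcell c) => //.
    by apply: char_preimage_closed; exact: bcell_closed.
move=> _ [w ow <-]; have : W w by rewrite Wodisk.
by move=> [_ [v [Sv _ <-]]]; exists v.
Qed.

Lemma ocell_closure d (K : set X) : closed K -> ocell d `<=` K -> cell d `<=` K.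
Proof.
move=> cK dK _ [w dw <-].
suff : (@disk R (dim d) `&` chi d @^-1` K) w by case.
apply: (odisk_dense (char_preimage_closed cK)) => // u ou.
by split; [exact: odisk_disk|apply: dK; exists u].
Qed.

(** The closed facets of [c] have a closed union, being finitely many, and are dense in its
    boundary, so they cover it. A boundary point thus lies in a facet, which is contained in [c],
    and induction on the dimension applies to that facet. *)
Lemma cell_normal c d x : cell c x -> ocell d x -> cell d `<=` cell c.
Proof.
have [n] := ubnP (dim c); elim: n c d x => // n IH c d x; rewrite ltnS => cn.
move=> cx dx; have [cx'|[v Sv vx]] := cell_cases cx.
  by rewrite (cw_disjoint dx cx').
have [D [finD Dlt Dcov]] := cw_boundary c.
pose T := [set e | D e /\ (dim c = (dim e).+1 /\
  exists2 v, @sphere R (dim c) v & ocell e (chi c v))].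
have finT : finite_set T by apply: sub_finite_set finD => e [].
have [[e [De [ce ev]] ex]|nx] := pselect ((\bigcup_(e in T) cell e) x).
  have ecn : (dim e < n)%N by rewrite -ltnS -ce.
  apply: subset_trans (IH e d x ecn ex dx) _.
  apply: subset_trans
    (ocell_closure (@bcell_closed c) (facet_sub_boundary ce ev)) _.
  exact: bcell_cell.
have cT : closed (\bigcup_(e in T) cell e).
  by apply: closed_bigcup_finite => // e _; exact: cell_closed.
have oV := closed_openC (char_preimage_closed (c := c) cT).
have Vv : (~` (@disk R (dim c) `&` chi c @^-1` (\bigcup_(e in T) cell e))) v.
  by move=> [_ /=]; rewrite vx.
have [e [w [ce Sw Vw ew]]] := facet_dense oV Sv Vv.
exfalso; apply: Vw; split; first exact: sphere_disk.
have [e' De' e'w] : (\bigcup_(e in D) ocell e) (chi c w) by apply: Dcov;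
  exists w.
have ee' := cw_disjoint ew e'w; rewrite -{}ee' in De' e'w.
by exists e; [split=> //; split=> //; exists w|exact: ocell_cell].
Qed.

End Cells.

(** * Barycentric coordinates *)

Section FaceIndex.
Context {R : realType} (X : regularCW R).
Local Notation dim := (@cw_dim R X).
Local Notation chi c := (@cw_char R X c).
Implicit Types (c d e : cw_index X) (x : X) (s t : face X).

Lemma ocell_center c : ocell c (chi c 0).
Proof. by exists 0 => //; rewrite odiskE enorm0. Qed.

Definition face_of c : face X :=
  SigSub (mem_set (ex_intro _ c erefl : @closed_cells R X (cell c))).

Lemma face_ofE c : face_set (face_of c) = cell c. Proof. by []. Qed.

Definition index_of s : cw_index X := projT1 (cid (set_mem (valP s))).

Lemma index_ofE s : cell (index_of s) = face_set s.
Proof. by rewrite /index_of /face_set; case: cid => c /= ->. Qed.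

Lemma index_ofK s : face_of (index_of s) = s.
Proof. by apply: val_inj; exact: index_ofE. Qed.

Lemma cell_sub_dim c d : cell d `<=` cell c -> d = c \/ (dim d < dim c)%N.
Proof. by move=> dc;
  exact: cell_ocell (dc _ (ocell_cell (ocell_center d))) (ocell_center d). Qed.

Lemma face_of_inj : injective face_of.
Proof.
move=> c d cd; have E : cell c = cell d by rewrite -!face_ofE cd.
have [//|dc] : c = d \/ (dim c < dim d)%N by apply: cell_sub_dim; rewrite E.
have [//|] : d = c \/ (dim d < dim c)%N by apply: cell_sub_dim; rewrite E.
by rewrite ltnNge ltnW.
Qed.

Lemma face_of_le c d : (face_of d <= face_of c)%O <-> cell d `<=` cell c.
Proof. exact: face_leP. Qed.

Definition carrier x : cw_index X := projT1 (cid (cw_cover x)).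

Lemma carrierP x : ocell (carrier x) x.
Proof. by rewrite /carrier; case: cid. Qed.

Lemma carrierE c x : ocell c x -> carrier x = c.
Proof. by move=> cx; exact: cw_disjoint (carrierP x) cx. Qed.

Lemma cell_carrier c x : cell c x <-> (face_of (carrier x) <= face_of c)%O.
Proof.
rewrite face_of_le; split=> [cx|]; first exact: cell_normal cx (carrierP x).
by apply; apply: ocell_cell; exact: carrierP.
Qed.

Lemma face_set_carrier s x : face_set s x <-> (face_of (carrier x) <= s)%O.
Proof. by rewrite -{2}(index_ofK s) -cell_carrier index_ofE. Qed.

(** A face below [s] is determined by the open cell that contains its centre, and [s] meets only
    finitely many open cells. *)
Lemma below_finite s : finite_set (below s).
Proof.
have [D [finD _ Dcov]] := cw_boundary (index_of s).
apply: (@sub_finite_set _ _ (face_of @` (index_of s |` D))); last first.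
  by apply: finite_image; rewrite finite_setU; split=> //; exact: finite_set1.
move=> t; rewrite /below /= => ts; exists (index_of t); last exact: index_ofK.
have cx : cell (index_of s) (chi (index_of t) 0).
  rewrite -face_ofE face_set_carrier index_ofK.
  by rewrite (carrierE (ocell_center _)) index_ofK.
have [sx|/Dcov[e De ex]] := cell_cases cx; [left|right].
  exact: cw_disjoint (ocell_center _) sx.
by rewrite (cw_disjoint (ocell_center _) ex).
Qed.

End FaceIndex.

Section Barycentric.
Context {R : realType} (X : regularCW R).
Local Notation dim := (@cw_dim R X).
Local Notation chi c := (@cw_char R X c).
Implicit Types (c d e : cw_index X) (x : X) (s t : face X).

(** The argument [n] bounds the dimension of the carrier. Under this bound the default 0 is reached
    only in dimension 0, where its factor [enorm v] vanishes. *)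
Fixpoint bary_rec n x s : R :=
  let c := carrier x in let v := cell_inv c x in
  (1 - enorm v) * (s == face_of c)%:R +
  enorm v * (if n is n'.+1 then bary_rec n' (chi c (unit_dir v)) s else 0).

(* Barycentric coordinates in the barycentric subdivision: the open cell c is
   the open cone over its boundary with apex the vertex c. *)
Definition bary x : face X -> R := bary_rec (dim (carrier x)) x.

Lemma carrier_inv x : @odisk R _ (cell_inv (carrier x) x) /\
  chi (carrier x) (cell_inv (carrier x) x) = x.
Proof.
have [v ov vx] := carrierP x; rewrite -[X in cell_inv _ X]vx.
by rewrite cell_invK//; exact: odisk_disk.
Qed.

Lemma carrier_bcell c v : @sphere R (dim c) v ->
  (dim (carrier (chi c v)) < dim c)%N.
Proof. by move=> Sv; apply: bcell_lower (carrierP _); exists v. Qed.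

Lemma enorm_dim0 n (v : 'rV[R]_n) : n = 0%N -> enorm v = 0.
Proof. by move=> n0; subst n; rewrite /enorm big_ord0 sqrtr0. Qed.

Lemma bary_rec_stable n m x s :
  (dim (carrier x) <= n)%N -> (dim (carrier x) <= m)%N ->
  bary_rec n x s = bary_rec m x s.
Proof.
elim: n m x => [|n IH] [|m] x //=.
- by rewrite leqn0 => /eqP /enorm_dim0 -> _; rewrite !mul0r.
- by move=> _; rewrite leqn0 => /eqP /enorm_dim0 ->; rewrite !mul0r.
- move=> xn xm; congr (_ + _).
  have [->|v0] := eqVneq (cell_inv (carrier x) x) 0;
    first by rewrite enorm0 !mul0r.
  have := carrier_bcell (unit_dir_sphere v0) => lt.
  by congr (_ * _); apply: IH; rewrite -ltnS; apply: leq_trans lt _.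
Qed.

Lemma bary_odisk c v s : @odisk R (dim c) v -> bary (chi c v) s =
  (1 - enorm v) * (s == face_of c)%:R + enorm v * bary (chi c (unit_dir v)) s.
Proof.
move=> ov; have cE : carrier (chi c v) = c by apply: carrierE; exists v.
rewrite /bary -[LHS](@bary_rec_stable (dim c).+1) ?cE//=.
rewrite cE cell_invK; last exact: odisk_disk.
congr (_ + _); have [->|v0] := eqVneq v 0; first by rewrite enorm0 !mul0r.
congr (_ * _); apply: bary_rec_stable => //.
by apply: ltnW; apply: carrier_bcell; exact: unit_dir_sphere.
Qed.

Lemma bary_disk c v s : @disk R (dim c) v -> bary (chi c v) s =
  (1 - enorm v) * (s == face_of c)%:R + enorm v * bary (chi c (unit_dir v)) s.
Proof.
move=> /disk_cases[/bary_odisk//|Sv]; rewrite unit_dir_id//.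
by move/sphereE: Sv => ->; rewrite subrr mul0r add0r mul1r.
Qed.

(** Projecting a point radially to the boundary of its carrier lowers the dimension of the
    carrier. *)
Lemma bary_ind (P : X -> Prop) :
  (forall c v, @odisk R (dim c) v ->
    (v != 0 -> P (chi c (unit_dir v))) -> P (chi c v)) ->
  forall x, P x.
Proof.
move=> H x; have [n] := ubnP (dim (carrier x)); elim: n x => // n IH x.
rewrite ltnS => xn; have [ov vx] := carrier_inv x; rewrite -vx;
  apply: H => // v0.
by apply: IH; apply: leq_trans xn; apply: carrier_bcell; exact: unit_dir_sphere.
Qed.

End Barycentric.

Section BarycentricBijection.
Context {R : realType} (X : regularCW R).
Local Notation dim := (@cw_dim R X).
Local Notation chi c := (@cw_char R X c).
Implicit Types (c d e : cw_index X) (x : X) (s t : face X).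

Lemma carrier_odisk c v : @odisk R (dim c) v -> carrier (chi c v) = c.
Proof. by move=> ov; apply: carrierE; exists v. Qed.

Lemma carrier_bcell_lt c v : @sphere R (dim c) v ->
  (face_of (carrier (chi c v)) < face_of c)%O.
Proof.
move=> Sv; rewrite lt_neqAle; apply/andP; split.
  apply/eqP => /face_of_inj E; have := carrier_bcell Sv.
  by rewrite E ltnn.
by apply/cell_carrier; apply: bcell_cell; exists v.
Qed.

Lemma bary_simplex x : exists2 A : {fset face X},
  chain_in (below (face_of (carrier x))) A & simplex A (bary x).
Proof.
elim/(@bary_ind R X): x => c v ov IH; rewrite carrier_odisk//.
have [v0|v0] := eqVneq v 0.
  have bE s : bary (chi c v) s = (s == face_of c)%:R.
    by rewrite bary_odisk// v0 enorm0 subr0 mul1r mul0r addr0.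
  exists [fset face_of c]%fset.
    split=> [s|s t]; first by rewrite in_fset1 => /eqP ->; exact: lexx.
    by rewrite !in_fset1 => /eqP -> /eqP ->; left.
  split=> [s|s|]; rewrite ?bE//; first by rewrite in_fset1 => /negPf ->.
  by rewrite big_seq_fset1 bE eqxx.
have Sv := unit_dir_sphere v0; have [A [Ab Ac] [A0 As A1]] := IH v0.
have lt_c s : s \in A -> (s < face_of c)%O.
  by move=> /Ab sc; apply: le_lt_trans sc (carrier_bcell_lt Sv).
have cA : face_of c \notin A by apply/negP => /lt_c; rewrite ltxx.
have v1 : enorm v <= 1 by apply/diskE; exact: odisk_disk.
exists (face_of c |` A)%fset.
  split=> [s|s t].
    by rewrite !in_fset1U => /orP[/eqP ->|/lt_c/ltW//]; exact: lexx.
  rewrite !in_fset1U => /orP[/eqP ->|sA] /orP[/eqP ->|tA].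
  - by left.
  - by right; exact/ltW/lt_c.
  - by left; exact/ltW/lt_c.
  - exact: Ac.
split=> [s|s|].
- by rewrite bary_odisk// addr_ge0 ?mulr_ge0 ?enorm_ge0 ?subr_ge0.
- rewrite !in_fset1U negb_or => /andP[/negPf sc sA].
  by rewrite bary_odisk// sc mulr0 add0r As// mulr0.
rewrite big_fsetU1//= bary_odisk// eqxx mulr1 As// mulr0 addr0.
rewrite (eq_big_seq (fun s => enorm v * bary (chi c (unit_dir v)) s)).
  by rewrite -mulr_sumr A1 mulr1 subrK.
move=> s sA; rewrite bary_odisk//; case: eqP => [E|_];
  last by rewrite mulr0 add0r.
by rewrite -E sA in cA.
Qed.

Lemma bary_ge0 x s : 0 <= bary x s.
Proof. by have [A _ []] := bary_simplex x. Qed.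

Lemma bary_support x s : bary x s != 0 -> (s <= face_of (carrier x))%O.
Proof.
have [A [Ab _] [_ As _]] := bary_simplex x; move=> bs; apply: Ab.
by apply: contraNT bs => /As ->.
Qed.

Lemma bary_le1 x s : bary x s <= 1.
Proof.
have [A _ [A0 As A1]] := bary_simplex x.
have [sA|/As ->//] := boolP (s \in A); rewrite -A1 (big_fsetD1 s)//= lerDl.
by apply: sumr_ge0.
Qed.

Lemma bary_apex c v : @odisk R (dim c) v ->
  bary (chi c v) (face_of c) = 1 - enorm v.
Proof.
move=> ov; rewrite bary_odisk// eqxx mulr1.
have [->|v0] := eqVneq v 0; first by rewrite enorm0 mul0r addr0.
suff -> : bary (chi c (unit_dir v)) (face_of c) = 0 by rewrite mulr0 addr0.
apply: contrapT => /eqP /bary_support /le_lt_trans.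
by move=> /(_ _ (carrier_bcell_lt (unit_dir_sphere v0))); rewrite ltxx.
Qed.

Lemma bary_carrier_gt0 x : 0 < bary x (face_of (carrier x)).
Proof.
have [ov vx] := carrier_inv x; rewrite -{1}vx bary_apex// subr_gt0.
exact/odiskE.
Qed.

(** The carrier is the largest face in the support, its coordinate gives the radius, and the other
    coordinates give the direction by induction. *)
Lemma bary_inj : injective (@bary R X).
Proof.
suff H x y : bary x =1 bary y -> x = y by move=> x y E; apply: H => s;
  rewrite E.
elim/(@bary_ind R X): x y => c v ov IH y E.
have carE : carrier y = c.
  apply: face_of_inj; apply/eqP; rewrite eq_le; apply/andP; split.
    rewrite -(carrier_odisk ov); apply: bary_support.
    by rewrite E gt_eqF// bary_carrier_gt0.
  apply: bary_support; rewrite -E gt_eqF//.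
  by have := bary_carrier_gt0 (chi c v); rewrite carrier_odisk.
have [ow wy] := carrier_inv y; move: (cell_inv _ y) ow wy;
  rewrite carE => w ow wy.
move: E; rewrite -wy => E {carE wy y}.
have evw : enorm v = enorm w.
  by have := E (face_of c); rewrite !bary_apex// => /addrI/oppr_inj.
have [v0|v0] := eqVneq v 0.
  by move: evw; rewrite v0 enorm0 => /esym/enorm_eq0 ->.
have w0 : w != 0.
  by apply: contraNneq v0 => w0; apply/eqP/enorm_eq0; rewrite evw w0 enorm0.
congr cw_char; rewrite -(unit_dirK v) -(unit_dirK w) evw; congr (_ *: _).
have Sv := unit_dir_sphere v0; have Sw := unit_dir_sphere w0.
apply: char_inj; [exact: sphere_disk|exact: sphere_disk|apply: IH => // s].
have := E s; rewrite (bary_odisk s ov) (bary_odisk s ow) evw => /addrI/mulfI.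
by apply; exact: enorm_neq0.
Qed.

Lemma chain_max (d' : Order.disp_t) (P : porderType d') (A : {fset P}) :
  chain_in setT A -> A != fset0 ->
  exists2 m, m \in A & forall z, z \in A -> (z <= m)%O.
Proof.
move=> [_ cA] /fset0Pn[x0 x0A].
suff H (l : seq P) : {subset l <= A} -> x0 \in l ->
    exists2 m, m \in l & forall z, z \in l -> (z <= m)%O.
  have [m mA Hm] := H (enum_fset A) (fun _ h => h) x0A.
  by exists m.
elim: l x0 {x0A} => // a l IH x0 lA _.
case: l IH lA => [|b l] IH lA.
  by exists a => [|z]; rewrite ?mem_head// inE => /eqP ->.
have lA' : {subset b :: l <= A} by move=> z zl; apply: lA; rewrite inE zl orbT.
have [m ml Hm] := IH b lA' (mem_head _ _).
have [am|ma] := cA a m (lA _ (mem_head _ _)) (lA' _ ml).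
  exists m; first by rewrite inE ml orbT.
  by move=> z; rewrite inE => /orP[/eqP ->//|/Hm].
exists a; first exact: mem_head.
by move=> z; rewrite inE => /orP[/eqP ->//|/Hm zm]; exact: le_trans zm ma.
Qed.

(** With [m] the largest face of the chain, the radius must be [1 - a m]. The other coordinates,
    rescaled to sum 1, belong by induction to a point of a smaller face, hence of the boundary of
    [m], and this point gives the direction. *)
Lemma bary_surj (A : {fset face X}) (a : face X -> R) :
  chain_in setT A -> simplex A a ->
  exists2 m, m \in A & exists2 x, face_set m x & bary x = a.
Proof.
have [n] := ubnP #|` A|; elim: n A a => // n IH A a;
  rewrite ltnS => An cA [a0 aA a1].
have A0 : A != fset0.
  by apply: contra_eq_neq a1 => ->; rewrite big_seq_fset0 eq_sym oner_neq0.
have [m mA mmax] := chain_max cA A0; exists m => //.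
pose c := index_of m; have cm : face_of c = m by exact: index_ofK.
have am1 : a m <= 1.
  by rewrite -a1 (big_fsetD1 m)//= lerDl; apply: sumr_ge0.
have sumA' : \sum_(z <- (A `\ m)%fset) a z = 1 - a m.
  by rewrite -a1 [in RHS](big_fsetD1 m)//= addrAC subrr add0r.
have [t0|t0] := eqVneq (1 - a m) 0.
  exists (chi c 0).
    by rewrite -index_ofE; apply: ocell_cell; exact: ocell_center.
  apply/funext => s;
    rewrite bary_odisk ?odiskE ?enorm0// subr0 mul1r mul0r addr0 cm.
  case: eqP => [->|/eqP sm]; first by move/eqP: t0; rewrite subr_eq0 => /eqP.
  have [sA|/aA//] := boolP (s \in A).
  have /eqP := sumA'; rewrite t0 psumr_eq0// => /allP /(_ s).
  by rewrite !in_fsetD1 sm sA => /(_ isT) /eqP.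
have tp : 0 < 1 - a m by rewrite lt_neqAle eq_sym t0 subr_ge0.
pose a' z := if z == m then 0 else a z / (1 - a m).
have [|||m' m'A [y m'y ya]] := IH (A `\ m)%fset a'.
- by apply: leq_trans An; rewrite [leqRHS](cardfsD1 m) mA.
- split=> // z w; rewrite !in_fsetD1 => /andP[_ zA] /andP[_ wA].
  by case: cA => _; apply.
- split=> [z|z|].
  + by rewrite /a'; case: eqP => // _; rewrite divr_ge0// ltW.
  + rewrite /a' !in_fsetD1 negb_and negbK => /orP[->//|/aA ->].
    by rewrite mul0r if_same.
  + rewrite (eq_big_seq (fun z => a z / (1 - a m))).
      by rewrite -mulr_suml sumA' divff.
    by move=> z; rewrite !in_fsetD1 /a' => /andP[/negPf ->].
have m'm : (m' < m)%O.
  by move: m'A; rewrite !in_fsetD1 lt_neqAle => /andP[-> /mmax].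
have cy : cell c y.
  by rewrite index_ofE; exact: (face_leP m' m).1 (ltW m'm) _ m'y.
have [|[u Su uy]] := cell_cases cy.
  move=> /carrierE yc; move: m'y; rewrite face_set_carrier yc cm.
  by move=> /le_lt_trans /(_ m'm); rewrite ltxx.
have eu : enorm ((1 - a m) *: u) = 1 - a m.
  by rewrite enormZ gtr0_norm//; move/sphereE: Su => ->; rewrite mulr1.
have dt : @disk R (dim c) ((1 - a m) *: u).
  by apply/diskE; rewrite eu lerBlDr lerDl.
exists (chi c ((1 - a m) *: u)); first by rewrite -index_ofE;
  exists ((1 - a m) *: u).
have e1 : 1 - (1 - a m) = a m by rewrite opprB addrC subrK.
apply/funext => s; rewrite bary_disk// eu unit_dirZ// uy ya cm /a' e1.
case: eqP => [->|_]; first by rewrite mulr1 mulr0 addr0.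
by rewrite mulr0 add0r mulrC divfK.
Qed.

End BarycentricBijection.

Lemma continuous_dominated {R : realType} {V : topologicalType} (g h : V ->
  R) x :
  {for x, continuous h} -> h x = 0 -> (forall y, `|g x - g y| <= h y) ->
  {for x, continuous g}.
Proof.
move=> ch hx gh; apply/cvgrPdist_lt => e e0.
have /cvgrPdist_lt/(_ _ e0) := ch; apply: filterS => y.
rewrite hx sub0r normrN => /(le_lt_trans (ler_norm _)).
exact: le_lt_trans (gh y).
Qed.

Section BarycentricContinuity.
Context {R : realType} (X : regularCW R).
Local Notation dim := (@cw_dim R X).
Local Notation chi c := (@cw_char R X c).
Implicit Types (c d e : cw_index X) (x : X) (s t : face X).

(* Continuity at the centre holds because the coordinates are bounded. *)
Lemma bary_char_continuous c s :
  {within @sphere R (dim c), continuous (fun v => bary (chi c v) s)} ->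
  {within @disk R (dim c), continuous (fun v => bary (chi c v) s)}.
Proof.
move=> cS; pose g (v : 'rV[R]_(dim c)) : R :=
  (1 - enorm v) * (s == face_of c)%:R +
  enorm v * bary (chi c (unit_dir v)) s.
apply: (@subspace_eq_continuous _ _ _ g).
  by move=> v /set_mem dv; exact: esym (bary_disk s dv).
apply: continuous_subspaceT => v.
have [->|v0] := eqVneq v 0; last first.
  apply: (@continuousD _ _ _ (fun v : 'rV[R]_(dim c) =>
    (1 - enorm v) * (s == face_of c)%:R)).
    apply: (@continuousM _ _ (fun v : 'rV[R]_(dim c) => 1 - enorm v) (fun=>
      (s == face_of c)%:R)).
      apply: (@continuousB R R^o _ (fun=> 1) (@enorm R (dim c))).
        exact: cst_continuous.
      exact: enorm_continuous.
    exact: cst_continuous.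
  apply: (@continuousM _ _ (@enorm R (dim c))); first exact: enorm_continuous.
  have cU : {within [set v : 'rV[R]_(dim c) | v != 0], continuous
      ((fun v => bary (chi c v) s) \o @unit_dir R (dim c))}.
    apply: within_comp cS; first by move=> w; exact: unit_dir_sphere.
    apply: continuous_in_subspaceT => w /set_mem; exact: unit_dir_continuous.
  rewrite continuous_open_subspace in cU; last exact: rV_neq0_open.
  by apply: cU; rewrite inE.
have g0 : g 0 = (s == face_of c)%:R
  by rewrite /g enorm0 subr0 mul1r mul0r addr0.
apply: (@continuous_dominated _ _ _ (@enorm R (dim c)));
  first exact: enorm_continuous.
  exact: enorm0.
move=> w; rewrite g0.
have -> : (s == face_of c)%:R - g w =
    enorm w * ((s == face_of c)%:R - bary (chi c (unit_dir w)) s)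
      by rewrite /g; ring.
rewrite normrM ger0_norm ?enorm_ge0//.
rewrite ler_piMr ?enorm_ge0//.
have := bary_ge0 (chi c (unit_dir w)) s;
  have := bary_le1 (chi c (unit_dir w)) s.
by rewrite ler_norml; case: (s == _) => /= h1 h2; apply/andP; split; lra.
Qed.

(** The boundary sphere is covered by the preimages of finitely many closed cells of lower
    dimension, so induction and closed pasting give continuity there; the cone formula extends it to
    the disk. *)
Lemma bary_continuous c s : {within cell c, continuous (fun x => bary x s)}.
Proof.
have [n] := ubnP (dim c); elim: n c => // n IH c; rewrite ltnS => cn.
apply: (@subspace_eq_continuous _ _ _
  ((fun v => bary (chi c v) s) \o cell_inv c)).
  by move=> _ /set_mem[v dv <-]; rewrite /from_subspace /= cell_invK.
apply: (@within_comp _ _ _ _ (@disk R (dim c)) _ _ _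
  (@cell_inv_continuous _ _ c)).
  by move=> _ [v dv <-]; rewrite cell_invK.
apply: bary_char_continuous.
have [D [finD Dlt Dcov]] := cw_boundary c.
apply/continuous_closedP => W cW; apply/closed_subspaceP.
exists (\bigcup_(d in D) (@disk R (dim c) `&`
    chi c @^-1` (cell d `&` (fun x => bary x s) @^-1` W))).
  apply: closed_bigcup_finite => // d Dd; apply: char_preimage_closed.
  apply: within_preimage_closed => //; first exact: cell_closed.
  by apply: IH; apply: leq_trans cn; exact: Dlt.
rewrite eqEsubset; split=> v [].
  by move=> [d Dd [_ [_ Wv]]] Sv.
move=> Wv Sv; split=> //.
have [d Dd dv] : (\bigcup_(d in D) ocell d) (chi c v) by apply: Dcov; exists v.
by exists d => //; split; [exact: sphere_disk|split=> //; exact: ocell_cell].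
Qed.

End BarycentricContinuity.

(** * Weak topologies *)

Lemma continuous_prod_topology (S : topologicalType) I (T : I ->
  topologicalType)
    (f : S -> prod_topology T) :
  (forall i, continuous (fun x => f x i)) -> continuous f.
Proof.
move=> cf x; apply/cvg_sup => i A [B [[V oV <-] Vfx] VA].
apply: filterS VA _; apply: cf; exact: open_nbhs_nbhs.
Qed.

Lemma set_val_continuous (T : topologicalType) (A : set T) :
  continuous (set_val : A -> T).
Proof. exact: initial_continuous. Qed.

Lemma continuous_set_type (S T : topologicalType) (A : set T) (f : S -> A) :
  continuous (fun x => set_val (f x)) -> continuous f.
Proof. by move=> /continuousP cf; apply/continuousP => _ [U oU <-];
  exact: cf. Qed.

Lemma within_comp_total (S T U : topologicalType) (A : set T) (f : S -> T) (g :
  T -> U) :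
  continuous f -> (forall x, A (f x)) -> {within A, continuous g} ->
  continuous (g \o f).
Proof.
move=> cf fA cg; apply/continuous_subspace_setT.
apply: (@within_comp _ _ _ setT A _ _ _ _ cg) => [x _|]; first exact: fA.
exact: (continuous_subspace_setT f).1 cf.
Qed.

Lemma set_type_compact (T : topologicalType) (A : set T) :
  compact A -> compact [set: A].
Proof.
move=> cA F PF _; pose G : set_system T := set_val @ F.
have GA : G A by apply: (@filterS _ F _ setT) => [a _|];
  [exact: set_valP a|exact: filterT].
have [p [Ap clp]] := cA G _ GA; exists (SigSub (mem_set Ap)); split=> // M B FM.
move=> [_ [[V oV <-] Vp] VB].
have : G (set_val @` M) by apply: (@filterS _ F _ M) => // x Mx; exists x.
move=> /clp /(_ (open_nbhs_nbhs (conj oV Vp)))[_ [[x Mx <-] Vx]].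
by exists x; split=> //; exact: VB.
Qed.

Lemma hausdorff_inj (S T : topologicalType) (f : S -> T) :
  continuous f -> injective f -> hausdorff_space T -> hausdorff_space S.
Proof.
move=> cf fi hT p q clpq; apply: fi; apply: hT => A B fpA fqB.
by have [x [Ax Bx]] := clpq _ _ (cf _ _ fpA) (cf _ _ fqB); exists (f x).
Qed.

Lemma tube_open (S Y : topologicalType) (N : set S) (W : set (S * Y)) :
  compact N -> open W -> open [set y | forall x, N x -> W (x, y)].
Proof.
move=> /compact_near_coveringP cN oW; rewrite openE => y Wy.
apply: (cN _ _ (fun y x => W (x, y))) => x Nx.
have : nbhs (x, y) W by apply: open_nbhs_nbhs; split=> //; exact: Wy.
by move=> [[P Q] PQ PQW]; exists (P, Q) => // -[a b] /= PQab; exact: PQW.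
Qed.

Section Coherent.
Context {Y Z : topologicalType} (F : set (set Y)) (G : set (set Z)).

Lemma coherent_openP (U : set Y) : @open (coherent F) U <->
  forall A, F A -> @open (subspace A) U.
Proof. by []. Qed.

Lemma coherent_closedP (C : set Y) : @closed (coherent F) C <->
  forall A, F A -> @closed (subspace A) C.
Proof.
split=> [cC A FA|H]; rewrite -[C]setCK.
  apply: (@open_closedC (subspace A)).
  have : @open (coherent F) (~` C) by exact: (@closed_openC (coherent F)).
  exact.
have oC : @open (coherent F) (~` C).
  by move=> A FA; apply: (@closed_openC (subspace A)); exact: H.
exact: (@open_closedC (coherent F)).
Qed.

Lemma coherent_id_continuous : continuous (id : coherent F -> Y).
Proof. by apply/continuousP => U oU; apply/coherent_openP => A FA;
  exact: open_subspaceW. Qed.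

Lemma coherent_member_continuous (S : topologicalType) (A : set Y) (f : S ->
  Y) :
  F A -> (forall x, A (f x)) -> continuous f ->
    continuous (f : S -> coherent F).
Proof.
move=> FA fA /continuousP cf;
  apply/continuousP => U /coherent_openP/(_ A FA)/open_subspaceP[V oV VU].
rewrite (_ : f @^-1` U = f @^-1` V); first exact: cf.
rewrite eqEsubset; split=> x fx.
  by have : (U `&` A) (f x) by []; rewrite -VU => -[].
by have : (V `&` A) (f x) by []; rewrite VU => -[].
Qed.

(** Regularity of [S] gives a neighbourhood of [x0] with compact closure [N] such that [h] maps the
    points of [N], paired with [y0], into [O]. The set of [y] for which all of [N] is mapped into
    [O] is open in the weak topology, by the tube lemma on each member of [F]. *)
Lemma coherent_prod_continuous (S : topologicalType) (h : S -> Y -> Z) :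
  compact [set: S] -> hausdorff_space S ->
  (forall y, exists2 A, F A & A y) ->
  (forall A, F A -> exists2 B, G B & forall x y, A y -> B (h x y)) ->
  continuous (fun p : S * Y => h p.1 p.2) ->
  continuous (fun p : S * coherent F => h p.1 p.2 : coherent G).
Proof.
move=> cS hS Fcov FG ch [x0 y0] M; rewrite nbhsE => -[O [oO Oxy] OM].
apply: filterS OM _.
have agree A : F A -> exists2 V, open V &
    forall x y, A y -> (O (h x y) <-> V (h x y)).
  move=> FA; have [B GB hB] := FG A FA.
  have /open_subspaceP[V oV VO] := oO B GB; exists V => // x y Ay.
  have Bxy := hB x y Ay; split=> Hxy.
    by have : (O `&` B) (h x y) by []; rewrite -VO => -[].
  by have : (V `&` B) (h x y) by []; rewrite VO => -[].
have oW V : open V -> open [set p : S * Y | V (h p.1 p.2)].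
  by move=> oV; apply: open_comp => // p _; exact: ch.
have [A0 FA0 A0y] := Fcov y0; have [V0 oV0 OV0] := agree A0 FA0.
have : nbhs x0 [set x | V0 (h x y0)].
  apply: (@filterS _ _ _ [set x | [set p : S * Y | V0 (h p.1 p.2)] (x, y0)]) =>
    //.
  have : @nbhs _ (S * Y)%type (x0, y0) [set p : S * Y | V0 (h p.1 p.2)].
    by apply: open_nbhs_nbhs; split; [exact: oW _ oV0|exact/OV0].
  move=> [[P Q] [Px Qy] PQ]; apply: filterS Px => x Px.
  by apply: (PQ (x, y0)); split=> //; exact: nbhs_singleton.
move=> /(compact_regular hS cS filterT)[N Nx NV].
have cN : compact (closure N) by apply: subclosed_compact cS _ => //;
  exact: closed_closure.
pose U := [set y : Y | forall x, closure N x -> O (h x y)].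
have oU : @open (coherent F) U.
  apply/coherent_openP => A FA; have [V oV OV] := agree A FA.
  apply/open_subspaceP; exists [set y | forall x, closure N x -> V (h x y)].
    by have := tube_open cN (oW V oV).
  by rewrite eqEsubset; split=> y [Hy Ay]; split=> // x Nx'; apply/(OV x y Ay);
    exact: Hy.
exists (closure N, U) => /=.
  split; first by apply: filterS Nx; exact: subset_closure.
  apply: open_nbhs_nbhs; split=> // x /NV Vx; exact/(OV0 _ _ A0y).
by move=> [x y] [/= Nx' Uy]; exact: Uy.
Qed.

End Coherent.

(** * Faces and order complexes *)

Section SimplexTopology.
Context {R : realType} {d : Order.disp_t} {P : porderType d}.

Lemma ptws_coord_continuous (x : P) :
  continuous (fun a : {ptws P -> (R : topologicalType)} => a x).
Proof. exact: (@proj_continuous P (fun=> R : topologicalType) x). Qed.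

Lemma simplex_closed (A : {fset P}) :
  closed (@simplex R d P A : set {ptws P -> (R : topologicalType)}).
Proof.
rewrite (_ :
  @simplex R d P A = (\bigcap_(x in [set: P]) (fun a : P -> R =>
  a x) @^-1` [set r | 0 <= r]) `&`
    ((\bigcap_(x in [set x | x \notin A]) (fun a : P -> R =>
      a x) @^-1` [set r | r = 0]) `&`
    (fun a : P -> R => \sum_(x <- A) a x) @^-1` [set r | r = 1])); last first.
  rewrite eqEsubset; split=> a.
    by move=> [a0 aA a1]; split=> [x _|]; [exact: a0|split=> // x; exact: aA].
  by move=> [a0 [aA a1]]; split=> [x|x xA|]; [exact: a0|exact: aA|exact: a1].
apply: closedI; last apply: closedI.
- apply: closed_bigI => x _;
  apply: (@closed_comp {ptws P -> (R : topologicalType)});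
  last exact: closed_ge.
  by move=> a _; exact: ptws_coord_continuous.
- apply: closed_bigI => x _;
  apply: (@closed_comp {ptws P -> (R : topologicalType)});
  last exact: closed_eq.
  by move=> a _; exact: ptws_coord_continuous.
apply: (@closed_comp {ptws P -> (R : topologicalType)}); last exact: closed_eq.
move=> a _; apply: (@continuous_big R P +%R) => [|x _];
  first exact: add_continuous.
exact: ptws_coord_continuous.
Qed.

Lemma chains_finite (Q : set P) : finite_set Q ->
  finite_set [set A : {fset P} | chain_in Q A].
Proof.
move=> /finite_fsetP[B QB]; apply: (@sub_finite_set _ _ [set` fpowerset B]).
  move=> A [AQ _]; rewrite /= fpowersetE; apply/fsubsetP => x /AQ.
  by rewrite QB.
exact: finite_fset.
Qed.

Lemma chain_inS (Q Q' : set P) (A : {fset P}) : Q `<=` Q' -> chain_in Q A ->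
  chain_in Q' A.
Proof. by move=> QQ' [AQ cA]; split=> // x /AQ /QQ'. Qed.

End SimplexTopology.

Section FaceComplex.
Context {R : realType} (X : regularCW R).
Implicit Types (x : X) (s t : face X).
Local Notation ptws := {ptws face X -> (R : topologicalType)}.

Lemma face_compact s : compact (face_set s).
Proof. by rewrite -index_ofE; exact: cell_compact. Qed.

Lemma face_closed s : closed (face_set s).
Proof. by rewrite -index_ofE; exact: cell_closed. Qed.

Lemma bary_below s x : face_set s x ->
  (\bigcup_(A in simplices (below s)) A) (bary x).
Proof.
rewrite face_set_carrier => xs; have [A cA sA] := bary_simplex x.
exists (simplex A) => //; exists A => //; apply: chain_inS cA => t /= tx.
exact: le_trans tx xs.
Qed.

Lemma bary_face_continuous s :
  {within face_set s, continuous (@bary R X : X -> ptws)}.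
Proof.
apply: continuous_prod_topology => t; rewrite -(index_ofE s).
exact: bary_continuous.
Qed.

Lemma ptws_hausdorff : hausdorff_space ptws.
Proof. by apply: hausdorff_product => t; exact: Rhausdorff. Qed.

(** There are finitely many chains below [s], and their simplices are closed, so continuity into the
    weak topology follows from continuity of the coordinates by closed pasting. *)
Lemma bary_coherent_continuous s (S : topologicalType) (u : S -> X) :
  continuous u -> (forall z, face_set s (u z)) ->
  continuous (fun z => bary (u z) : coherent (@simplices R _ _ (below s))).
Proof.
move=> cu us; have cb : continuous ((@bary R X : X -> ptws) \o u).
  exact: within_comp_total cu us (@bary_face_continuous s).
apply/continuous_closedP => C /coherent_closedP cC.
rewrite (_ : _ @^-1` C = \bigcup_(A in [set A | chain_in (below s) A])
    ((@bary R X : X -> ptws) \o u) @^-1` (C `&` simplex A)); last first.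
  rewrite eqEsubset; split=> z; last by move=> [A _ []].
  move=> Cz; have [_ [A cA <-] sA] := bary_below (us z).
  by exists A.
apply: closed_bigcup_finite => [|A cA].
  by apply: chains_finite; exact: below_finite.
apply: closed_comp => [z _|]; first exact: cb.
have /closed_subspaceP[V cV <-] : @closed (@subspace ptws (simplex A)) C.
  by apply: cC; exists A.
exact: (@closedI ptws _ _ cV (@simplex_closed R _ _ A)).
Qed.

Definition to_complex s x (sx : face_set s x) : order_complex R (below s) :=
  SigSub (mem_set (bary_below sx)).

Lemma of_complex_subproof s (a : order_complex R (below s)) :
  exists x, face_set s x /\ bary x = val a.
Proof.
have [_ [A cA <-] sA] := set_valP a.
have [m mA [x mx xa]] := bary_surj (chain_inS (fun _ _ => I) cA) sA.
exists x; split=> //; apply: (face_leP m s).1 mx.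
by case: cA => /(_ m mA).
Qed.

Definition of_complex s (a : order_complex R (below s)) : face_set s :=
  SigSub (mem_set (projT2 (cid (of_complex_subproof a))).1).

Lemma of_complexK s (a : order_complex R (below s)) :
  bary (set_val (of_complex a)) = val a.
Proof. by rewrite /of_complex; case: cid => x []. Qed.

(** A closed part of a face is compact, so its image under the coordinates is compact in a Hausdorff
    space and hence closed. *)
Lemma of_complex_continuous s : continuous (@of_complex s).
Proof.
apply: continuous_set_type; apply/continuous_closedP => C cC.
have cB : closed ((@bary R X : X -> ptws) @` (face_set s `&` C)).
  apply: (compact_closed ptws_hausdorff); apply: continuous_compact.
    by apply: continuous_subspaceW (@bary_face_continuous s); exact: subIsetl.
  exact: compact_closedI (@face_compact s) cC.
rewrite (_ :
  _ @^-1` C = set_val @^-1` ((@bary R X : X -> ptws) @` (face_set s `&` C))).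
  apply: closed_comp => [a _|].
    exact: (continuous_comp (@set_val_continuous _ _ a)
      (@coherent_id_continuous _ _ _)).
  exact: cB.
rewrite eqEsubset; split=> a /=.
  move=> Ca; exists (set_val (of_complex a)); last exact: of_complexK.
  by split=> //; exact: set_valP.
by move=> [x [sx Cx]]; rewrite -[RHS]of_complexK => /bary_inj <-.
Qed.

End FaceComplex.

(** * Gluing *)

Lemma set_val_closed_image (T : topologicalType) (A : set T) (D : set A) :
  closed A -> closed D -> closed (set_val @` D).
Proof.
move=> cA /closed_openC[U oU UD].
rewrite (_ : set_val @` D = A `&` ~` U); first by apply: closedI => //;
  exact: open_closedC.
have DU a : D a <-> ~ U (set_val a).
  have : (set_val @^-1` U) a = (~` D) a by rewrite UD.
  by move=> /= ->; split=> [Da|/contrapT].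
rewrite eqEsubset; split=> [_ [a Da <-]|x [Ax Ux]].
  by split; [exact: set_valP|apply/DU].
by exists (SigSub (mem_set Ax)) => //; apply/DU.
Qed.

Lemma finite_families (T : choiceType) n (Q : 'I_n -> set T) :
  (forall i, finite_set (Q i)) ->
  finite_set [set c : 'I_n -> T | forall i, Q i (c i)].
Proof.
move=> fQ; have /finite_fsetP[B QB] :
  finite_set (\bigcup_(i in [set: 'I_n]) Q i).
  by apply: bigcup_finite => //; exact: finite_finset.
apply: (@sub_finite_set _ _ ((fun (g : {ffun 'I_n -> B}) i =>
  val (g i)) @` setT)).
  move=> c Qc; have cB i : c i \in B.
    have : (\bigcup_(i in [set: 'I_n]) Q i) (c i) by exists i.
    by rewrite QB.
  by exists [ffun i => FSetSub (cB i)] => //; apply/funext => i; rewrite ffunE.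
by apply: finite_image; exact: finite_finset.
Qed.

Lemma continuous_pair (S T U : topologicalType) (f : S -> T) (g : S -> U) :
  continuous f -> continuous g -> continuous (fun x => (f x, g x)).
Proof. by move=> cf cg x; apply: cvg_pair; [exact: cf|exact: cg]. Qed.

Section FunCons.
Context {T : Type} {n : nat}.

Definition fcons (x : T) (y : 'I_n -> T) : 'I_n.+1 -> T :=
  fun i => if unlift ord0 i is Some j then y j else x.

Definition ftail (q : 'I_n.+1 -> T) : 'I_n -> T := fun j => q (lift ord0 j).

Lemma fcons0 x y : fcons x y ord0 = x. Proof.
  by rewrite /fcons unlift_none. Qed.

Lemma fconsS x y j : fcons x y (lift ord0 j) = y j. Proof.
  by rewrite /fcons liftK. Qed.

Lemma ftail_cons x y : ftail (fcons x y) = y.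
Proof. by apply/funext => j; rewrite /ftail fconsS. Qed.

Lemma fconsK q : fcons (q ord0) (ftail q) = q.
Proof.
apply/funext => i; have [j ->|->] := unliftP ord0 i; first by rewrite fconsS.
by rewrite fcons0.
Qed.

End FunCons.

Section Gluing.
Context {R : realType} (X : regularCW R) (n : nat).
Implicit Types (s t : face X) (x : X).
Local Notation ptws m := (prod_topology (fun _ : 'I_m => cw_space X)).
Local Notation F := (conf_functor X n).

Definition disjoint_faces m (c : 'I_m -> face X) :=
  forall i j, i != j -> face_set (c i) `&` face_set (c j) = set0.

Lemma cell_product_closed m (c : 'I_m -> face X) :
  closed (cell_product c : set (ptws m)).
Proof.
rewrite (_ : cell_product c = \bigcap_(i in [set: 'I_m])
    (fun q : ptws m => q i) @^-1` face_set (c i)).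
  apply: closed_bigI => i _; apply: (@closed_comp (ptws m)).
    by move=> q _; exact: (@proj_continuous _ (fun=> X : topologicalType) i q).
  exact: face_closed.
by rewrite eqEsubset; split=> q Hq i; [move=> _; exact: Hq|exact: Hq].
Qed.

(** Here the product topology on the left meets the weak topology on the right; compactness of the
    face reconciles them. *)
Lemma fcons_continuous s :
  continuous (fun p : face_set s * cw_power X n => fcons (set_val p.1) p.2 :
    cw_power X n.+1).
Proof.
apply: (@coherent_prod_continuous (ptws n) (ptws n.+1)
  [set cell_product c | c in [set: 'I_n -> face X]]
  [set cell_product c | c in [set: 'I_n.+1 -> face X]] (face_set s)
  (fun (x : face_set s) (y : 'I_n -> X) => fcons (set_val x) y)).
- exact: set_type_compact (@face_compact _ _ s).
- apply: (hausdorff_inj (@set_val_continuous _ _)) (@cw_hausdorff R X).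
  exact: val_inj.
- move=> y; exists (cell_product (fun i => face_of (carrier (y i)))).
    by exists (fun i => face_of (carrier (y i))).
  by move=> i; apply/face_set_carrier; exact: lexx.
- move=> _ [c _ <-]; exists (cell_product (fcons s c));
  first by exists (fcons s c).
  move=> x y cy i; have [j ->|->] := unliftP ord0 i; first by rewrite !fconsS;
    exact: cy.
  by rewrite !fcons0; exact: set_valP.
apply: continuous_prod_topology => i; have [j ->|->] := unliftP ord0 i.
  rewrite (_ : (fun p => _) = (fun y : ptws n => y j) \o snd); last first.
    by apply/funext => p; rewrite /= fconsS.
  move=> p; apply: continuous_comp; first exact: cvg_snd.
  exact: (@proj_continuous _ (fun=> X : topologicalType) j).
rewrite (_ : (fun p => _) = set_val \o fst); last first.
  by apply/funext => p; rewrite /= fcons0.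
move=> p; apply: continuous_comp; first exact: cvg_fst.
exact: set_val_continuous.
Qed.

Lemma disjoint_facesS m (c c' : 'I_m -> face X) : (forall i, (c' i <= c i)%O) ->
  disjoint_faces c -> disjoint_faces c'.
Proof.
move=> c'c dc i j ij; apply/seteqP; split=> // x [xi xj].
rewrite -(dc i j ij); split; first exact: (face_leP _ _).1 (c'c i) _ xi.
exact: (face_leP _ _).1 (c'c j) _ xj.
Qed.

Lemma glue_subproof s (a : order_complex R (below s)) (p :
  Conf n (avoiding s)) :
  conf_set (full X) (fcons (set_val (of_complex a)) (set_val p)).
Proof.
have [c [cs dc pc]] := set_valP p; exists (fcons s c); split=> //.
  move=> i j; have [i' ->|->] := unliftP ord0 i;
    have [j' ->|->] := unliftP ord0 j.
  - by rewrite !fconsS (inj_eq lift_inj); exact: dc.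
  - by rewrite fconsS fcons0 => _; exact: cs.
  - by rewrite fconsS fcons0 => _; rewrite setIC; exact: cs.
  - by rewrite eqxx.
move=> i; have [j ->|->] := unliftP ord0 i; first by rewrite !fconsS; exact: pc.
by rewrite !fcons0; exact: set_valP.
Qed.

Definition glue_at s (ap : order_complex R (below s) * Conf n (avoiding s)) :
  Conf n.+1 (full X) := SigSub (mem_set (glue_subproof ap.1 ap.2)).

Definition glue (z : hocolim_objects R F) : Conf n.+1 (full X) :=
  glue_at (projT2 z).

Lemma glue_continuous : continuous glue.
Proof.
suff cs s : continuous (@glue_at s).
  by move=> [s ap] U nU; exact: (cs s ap U nU).
apply: continuous_set_type => -[a p].
apply: (@continuous_comp _ (face_set s * cw_power X n)%type _
  (fun ap => (of_complex ap.1, set_val ap.2))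
  (fun xp => fcons (set_val xp.1) xp.2 : cw_power X n.+1)).
  apply: continuous_pair => {a p} -[a p].
    by apply: (@continuous_comp _ _ _ fst);
      [exact: cvg_fst|exact: of_complex_continuous].
  by apply: (@continuous_comp _ _ _ snd);
    [exact: cvg_snd|exact: set_val_continuous].
exact: fcons_continuous.
Qed.

Lemma glue_arrow (z : hocolim_arrows R F) :
  glue (hocolim_f z) = glue (hocolim_g z).
Proof.
case: z => xy [a p]; apply: val_inj => /=; congr fcons.
by apply: bary_inj; rewrite !of_complexK.
Qed.

Lemma glue_rel (z w : hocolim_objects R F) :
  coeq_rel (@hocolim_f R _ _ F) (@hocolim_g R _ _ F) z w -> glue z = glue w.
Proof.
move=> /asboolP; elim=> {z w} [z w [a [-> ->]]|//|z w _ ->//|z w y _ -> _ ->//].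
exact: glue_arrow.
Qed.

Local Notation rel_F := (coeq_rel (@hocolim_f R _ _ F) (@hocolim_g R _ _ F)).
Local Notation Q := (hocolim R F).

Definition hproj (z : hocolim_objects R F) : Q := \pi_Q z.

Lemma hproj_continuous : continuous hproj.
Proof. exact: pi_continuous. Qed.

Lemma hprojP (z w : hocolim_objects R F) : hproj z = hproj w <-> rel_F z w.
Proof. by split=> [/eqquotP|zw]; last exact/eqquotP. Qed.

Lemma hprojK (q : Q) : hproj (repr q) = q. Proof. exact: reprK. Qed.

(** If [t < s], the two representatives are the two ends of the single arrow [(a, p')]. *)
Lemma hproj_le s t (a : order_complex R (below t)) (a' :
  order_complex R (below s))
    (p : Conf n (avoiding t)) (p' : Conf n (avoiding s)) :
  (t <= s)%O -> val a = val a' -> val p = val p' ->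
  hproj (existT _ t (a, p)) = hproj (existT _ s (a', p')).
Proof.
rewrite le_eqVlt => /orP[/eqP ts|ts] aa' pp'.
  by subst t; rewrite (val_inj aa') (val_inj pp').
apply/hprojP/asboolP; apply: rst_step.
exists (existT _ (exist (fun xy : face X * face X => (xy.1 < xy.2)%O) (t,
  s) ts) (a, p')).
split; congr existT; congr pair; exact: val_inj.
Qed.

Lemma conf_tail m (c : 'I_m.+1 -> face X) (q : 'I_m.+1 -> X) :
  disjoint_faces c -> cell_product c q ->
  @conf_set R X m (avoiding (c ord0)) (ftail q).
Proof.
move=> dc cq; exists (ftail c); split=> [j|i j ij|j].
- by apply: dc; rewrite eq_sym neq_lift.
- by apply: dc; rewrite (inj_eq lift_inj).
- exact: cq.
Qed.

Section Slice.
Variables (c : 'I_n.+1 -> face X) (dc : disjoint_faces c).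

(** The inverse on one product of disjoint faces: the first point is represented at the fixed face
    [c ord0] instead of its carrier, which makes the formula continuous on the whole product. *)
Definition slice (q : cell_product c) : hocolim_objects R F :=
  existT _ (c ord0) (to_complex (set_valP q ord0),
    SigSub (mem_set (conf_tail dc (set_valP q)))).

Let A : set (ptws n.+1) := cell_product c.

Lemma slice_continuous : continuous (slice : A -> hocolim_objects R F).
Proof.
have cproj i : continuous (fun q : A => set_val q i).
  move=> q; apply: (@continuous_comp _ (ptws n.+1) _ set_val (fun q => q i)).
    exact: set_val_continuous.
  exact: (@proj_continuous _ (fun=> X : topologicalType) i).
move=> q; apply: (@continuous_comp _ _ _ (fun q : A => _) (existT _ (c ord0)));
  last first.
  exact: existT_continuous.
apply: continuous_pair => {}q.
  apply: continuous_set_type; apply: bary_coherent_continuous;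
    first exact: cproj.
  by move=> z; exact: (set_valP z).
apply: continuous_set_type.
apply: (@coherent_member_continuous (ptws n) _ _ (cell_product (ftail c))).
- by exists (ftail c).
- by move=> z j; exact: (set_valP z).
- by apply: continuous_prod_topology => j; exact: cproj.
Qed.

End Slice.

Lemma conf_carrier (q : Conf n.+1 (full X)) :
  disjoint_faces (fun i => face_of (carrier (val q i))).
Proof.
have [c [_ dc qc]] := set_valP q; apply: disjoint_facesS dc => i.
by apply/face_set_carrier; exact: qc.
Qed.

Lemma cell_product_carrier m (q : 'I_m -> X) :
  cell_product (fun i => face_of (carrier (q i))) q.
Proof. by move=> i; apply/face_set_carrier; exact: lexx. Qed.

Definition unglue (q : Conf n.+1 (full X)) : Q :=
  hproj (slice (@conf_carrier q)
    (SigSub (mem_set (cell_product_carrier (val q))))).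

(** The carrier of the first point lies below [c ord0], so one arrow at most separates the two
    representatives. *)
Lemma unglueE (c : 'I_n.+1 -> face X) (dc : disjoint_faces c) (q :
  cell_product c)
    (q' : Conf n.+1 (full X)) : set_val q = val q' ->
  unglue q' = hproj (slice dc q).
Proof.
move=> qq'; apply: hproj_le => /=.
- by rewrite -qq'; apply/face_set_carrier; exact: (set_valP q).
- by rewrite -qq'.
- by rewrite -qq'.
Qed.

Lemma glueK : cancel (glue \o repr : Q -> _) unglue.
Proof.
move=> q; rewrite -[RHS]hprojK /=; case: (repr q) => s [a p].
apply: hproj_le => /=.
- by rewrite fcons0; apply/face_set_carrier; exact: set_valP.
- by rewrite fcons0 of_complexK.
- by rewrite ftail_cons.
Qed.

Lemma glue_repr (z : hocolim_objects R F) : glue (repr (hproj z)) = glue z.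
Proof. by apply: glue_rel; apply/hprojP; exact: hprojK. Qed.

Lemma unglueK : cancel unglue (glue \o repr : Q -> _).
Proof.
move=> q; rewrite /= glue_repr; apply: val_inj; rewrite /= -[RHS]fconsK;
  congr fcons.
by apply: bary_inj; rewrite of_complexK.
Qed.

Lemma glue_repr_continuous : continuous (glue \o repr : Q -> _).
Proof.
apply/quotient_continuous; rewrite (_ : _ \o _ = glue);
  first exact: glue_continuous.
by apply/funext => z; exact: glue_repr.
Qed.

(** In the weak topology closedness is tested on one product of faces at a time. Its points that are
    configurations lie in finitely many closed products of disjoint smaller faces, and on each of
    these the map is the projection of a [slice]. *)
Lemma unglue_continuous : continuous unglue.
Proof.
apply/continuous_closedP => C cC.
pose Z : set (ptws n.+1) := set_val @` (unglue @^-1` C).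
have -> : unglue @^-1` C = set_val @^-1` Z.
  rewrite eqEsubset; split=> q; first by move=> Cq; exists q.
  by move=> [q' Cq' /val_inj <-].
apply: (@closed_comp _ (cw_power X n.+1)) => [q _|].
  exact: set_val_continuous.
apply/coherent_closedP => _ [s _ <-]; apply/closed_subspaceP.
exists (Z `&` cell_product s); last by rewrite -setIA setIid.
pose D (c : 'I_n.+1 -> face X) := [set c' : 'I_n.+1 -> face X |
  (forall i, below (c i) (c' i)) /\ disjoint_faces c'].
(* The disjointness proof is bound inside, so that [m] is a family over all [c]; proof irrelevance
   identifies it with the given one. *)
pose m (c : 'I_n.+1 -> face X) : set (ptws n.+1) := [set q |
  exists (dc : disjoint_faces c) (q' : cell_product c), set_val q' = q /\
    C (hproj (slice dc q'))].
rewrite (_ : Z `&` _ = \bigcup_(c in D s) m c).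
  apply: closed_bigcup_finite => [|c [_ dc]].
    apply: (@sub_finite_set _ _ [set c : 'I_n.+1 -> face X | forall i,
      below (s i) (c i)]).
      by move=> c [].
    by apply: (@finite_families (face X) _ (fun i => below (s i))) => i;
      exact: below_finite.
  rewrite (_ : m c = set_val @` ((hproj \o slice dc) @^-1` C)).
    apply: (@set_val_closed_image (ptws n.+1));
      first exact: cell_product_closed.
    apply: (@closed_comp (set_type (cell_product c : set (ptws n.+1))) Q
      (hproj \o slice dc)) => // q _.
    by apply: continuous_comp;
      [exact: slice_continuous|exact: hproj_continuous].
  rewrite eqEsubset; split=> q.
    by move=> [dc' [q' [<- Cq']]]; exists q' => //=;
      rewrite (Prop_irrelevance dc dc').
  by move=> [q' Cq' <-]; exists dc, q'.
rewrite eqEsubset; split=> q.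
  move=> [[q' Cq' <-] sq']; exists (fun i => face_of (carrier (val q' i))).
    split; last exact: conf_carrier.
    by move=> i; apply/face_set_carrier; exact: sq'.
  by exists (@conf_carrier q'),
    (SigSub (mem_set (cell_product_carrier (val q')))).
move=> [c [cs _] [dc [q' [<- Cq']]]]; have cq' := set_valP q'.
have fq' : @conf_set R X n.+1 (full X) (set_val q') by exists c.
split; last by move=> i; exact: (face_leP _ _).1 (cs i) _ (cq' i).
exists (SigSub (mem_set fq')) => //=.
by rewrite /preimage /= (@unglueE c dc q').
Qed.

End Gluing.

Theorem theorem4p2 (R : realType) (X : regularCW R) (r : nat)
    (hr : (2 <= r)%N) :
  homeomorphic (Conf r (full X)) (hocolim R (conf_functor X r.-1)).
Proof.
case: r hr => // n _; exists (@unglue R X n), (glue (n := n) \o repr); split.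
- exact: unglue_continuous.
- exact: glue_repr_continuous.
- exact: unglueK.
- exact: glueK.
Qed.
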